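(* Let $P\subset\mathbb{R}^n$ be an $n$-dimensional polytope with vertices in $\mathbb{Z}^n$, and let $\rho(P)$ be the maximum, over all systems $f_1=\cdots=f_n=0$ of real polynomials $f_i\in\mathbb{R}[x_1,\ldots,x_n]$ with Newton polytope $\mathrm{New}(f_i)=P$ for all $i$ and having only finitely many (simple) solutions in $(\mathbb{C}^\times)^n$, of the number of solutions in $(\mathbb{R}^\times)^n$. Then for every regular triangulation $P_w$ of $P$, $$\#\{\text{odd cells of } P_w\}\ \le\ \rho(P).$$
   Context: The Newton polytope $\mathrm{New}(f)$ of a polynomial $f$ is the convex hull of the exponent vectors of its monomials. Given a lifting function $w\colon P\cap\mathbb{Z}^n\to\mathbb{Q}_{\ge0}$, let $Q=\mathrm{conv}\{(a,w(a)) : a\in P\cap\mathbb{Z}^n\}\subset\mathbb{R}^{n+1}$; its lower facets are those whose inward normal has positive last coordinate, and their projections to $\mathbb{R}^n$ form the regular subdivision $P_w$ of $P$. It is a regular triangulation if every lattice point of $P$ lifts to a vertex of a lower facet and all lower facets are simplices. The cells of $P_w$ are its full-dimensional simplices. For a lattice $n$-simplex $F$ with vertices $v_0,\ldots,v_n$, let $d_1\mid\cdots\mid d_n$ be the invariant factors (Smith normal form diagonal entries) of the integer matrix with columns $v_i-v_0$; $F$ is an odd cell if all $d_i$ are odd (equivalently its normalized volume $n!\,\mathrm{Vol}(F)=d_1\cdots d_n$ is odd). *)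

(* Defs.v *)
From HB Require Import structures.
From mathcomp Require Import all_boot all_order all_algebra.
From mathcomp Require Import reals complex finmap.
Set Implicit Arguments. Unset Strict Implicit. Unset Printing Implicit Defensive.
Import Order.TTheory GRing.Theory Num.Theory.
Local Open Scope ring_scope.
Local Open Scope fset_scope.
Local Open Scope complex_scope.

Definition pt (n : nat) := 'cV[int]_n.

Section Polytopes.
Variables (R : realType) (n : nat).

Definition realv (a : pt n) : 'cV[R]_n := map_mx (fun z : int => z%:~R) a.

Definition convR (k : nat) (X : seq 'cV[R]_k) (x : 'cV[R]_k) : Prop :=
  exists l : 'I_(size X) -> R,
    (forall i, 0 <= l i) /\ \sum_i l i = 1 /\ x = \sum_i l i *: X`_i.

Definition convZ (X : seq (pt n)) (x : 'cV[R]_n) : Prop := convR (map realv X) x.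

Definition lattice_pt (V : seq (pt n)) (a : pt n) : Prop := convZ V (realv a).

Definition diffmx (v : 'I_n.+1 -> pt n) : 'M[int]_n :=
  \matrix_(i < n, j < n) (v (lift ord0 j) i 0 - v ord0 i 0).

Definition full_dim (X : seq (pt n)) : Prop :=
  exists v : 'I_n.+1 -> pt n, (forall i, v i \in X) /\ \det (diffmx v) != 0.

Definition affv (c : 'cV[R]_n) (d : R) (a : pt n) : R := (c^T *m realv a) 0 0 + d.

Definition liftpt (w : pt n -> rat) (a : pt n) : 'cV[R]_(n + 1) :=
  col_mx (realv a) (ratr (w a))%:M.

(* E is the set of lattice points of P whose lifts lie on a lower facet of
   Q = conv{(a, w a)}: there is a supporting hyperplane y = c.x + d with Q
   above it (inward normal with positive last coordinate), E is the set of
   lattice points whose lift lies on it, and the face it cuts out is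
   n-dimensional. *)
Definition lower_facet (V : seq (pt n)) (w : pt n -> rat) (E : {fset pt n}) : Prop :=
  exists (c : 'cV[R]_n) (d : R),
    (forall a, lattice_pt V a -> affv c d a <= ratr (w a)) /\
    (forall a, a \in E <-> lattice_pt V a /\ affv c d a = ratr (w a)) /\
    full_dim (enum_fset E).

Definition vertex_of (w : pt n -> rat) (E : {fset pt n}) (a : pt n) : Prop :=
  a \in E /\ ~ convR (map (liftpt w) (rem a (enum_fset E))) (liftpt w a).

(* the (n-dimensional) face with generators E is a simplex: n+1 vertices *)
Definition simplex_face (w : pt n -> rat) (E : {fset pt n}) : Prop :=
  exists v : 'I_n.+1 -> pt n, injective v /\
    (forall a, vertex_of w E a <-> exists i, a = v i).

Definition regular_triangulation (V : seq (pt n)) (w : pt n -> rat) : Prop :=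
  (forall a, lattice_pt V a -> exists E, lower_facet V w E /\ vertex_of w E a) /\
  (forall E, lower_facet V w E -> simplex_face w E).

(* E determines a cell of P_w (projection of a lower facet) which is odd:
   its normalized volume |det(v_1 - v_0, ..., v_n - v_0)| is odd *)
Definition odd_cell (V : seq (pt n)) (w : pt n -> rat) (E : {fset pt n}) : Prop :=
  lower_facet V w E /\
  exists v : 'I_n.+1 -> pt n,
    (forall a, vertex_of w E a <-> exists i, a = v i) /\
    odd `|\det (diffmx v)|%N.

(* A system f_1..f_n is given by a finite list S of exponents and real
   coefficients c i a, f_i = sum_(a in S) c i a x^a. *)
Definition mon (F : unitRingType) (z : 'cV[F]_n) (a : pt n) : F :=
  \prod_(k < n) z k 0 ^ a k 0.

Definition evalR (S : seq (pt n)) (c : 'I_n -> pt n -> R) (i : 'I_n)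
  (x : 'cV[R]_n) : R := \sum_(a <- S) c i a * mon x a.

Definition evalC (S : seq (pt n)) (c : 'I_n -> pt n -> R) (i : 'I_n)
  (z : 'cV[R[i]]_n) : R[i] := \sum_(a <- S) (c i a)%:C * mon z a.

Definition jacC (S : seq (pt n)) (c : 'I_n -> pt n -> R) (z : 'cV[R[i]]_n)
  : 'M[R[i]]_n :=
  \matrix_(i < n, j < n)
     \sum_(a <- S) (c i a)%:C * (a j 0)%:~R * mon z (a - delta_mx j 0).

Definition supp (S : seq (pt n)) (c : 'I_n -> pt n -> R) (i : 'I_n) : seq (pt n) :=
  [seq a <- S | c i a != 0].

Definition solC (S : seq (pt n)) (c : 'I_n -> pt n -> R) (z : 'cV[R[i]]_n) : Prop :=
  (forall k, z k 0 != 0) /\ forall i, evalC S c i z = 0.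

Definition solR (S : seq (pt n)) (c : 'I_n -> pt n -> R) (x : 'cV[R]_n) : Prop :=
  (forall k, x k 0 != 0) /\ forall i, evalR S c i x = 0.

Definition admissible (V : seq (pt n)) (S : seq (pt n)) (c : 'I_n -> pt n -> R)
  : Prop :=
  uniq S /\
  (forall i x, convZ (supp S c i) x <-> convZ V x) /\
  (exists s : seq 'cV[R[i]]_n, forall z, solC S c z -> z \in s) /\
  (forall z, solC S c z -> \det (jacC S c z) != 0).

(* some admissible system has exactly m solutions in (R^x)^n ;
   rho(P) is the maximum of such m *)
Definition rho_attained (V : seq (pt n)) (m : nat) : Prop :=
  exists (S : seq (pt n)) (c : 'I_n -> pt n -> R),
    admissible V S c /\
    exists s : seq 'cV[R]_n, uniq s /\ (forall x, x \in s <-> solR S c x) /\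
      size s = m.

End Polytopes.

(* Main.v *)
Require Import Defs.
From HB Require Import structures.
From mathcomp Require Import all_boot all_order all_algebra.
From mathcomp Require Import reals complex finmap.
From mathcomp Require Import ring lra zify.
From mathcomp Require mpoly boolp.
Import Order.TTheory GRing.Theory Num.Theory.
Local Open Scope ring_scope.
Set Implicit Arguments.
Unset Strict Implicit.
Unset Printing Implicit Defensive.

(* Take f_i = sum_a (mu_a^i e^(-t w(a)) + y_i [a = a0]) x^a over all lattice points
   a of P, with distinct mu_a >= 1, t large and y > 0 small and generic. If the
   lower facet E lies on the graph of c.x + d, then in the coordinates
   x_k = e^(t c_k) z_k the system is a small perturbation of its restriction to the
   n+1 vertices of E. That restriction prescribes the monomials z^(v_j - v_0) to be
   certain nonzero numbers, and an odd matrix of exponents makes this solvable over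
   the reals; by contraction in logarithmic coordinates a real solution persists.
   The cell is recovered from the solution as the set of dominant terms.
   Finiteness and simplicity of the complex solutions come from the choice of y.
   The equations read y_i = g_i(z) with Laurent polynomials g_i, and counting
   dimensions gives for each j a nonzero R_j(Y, X) with R_j(g(z), z_j) = 0, which
   can be taken coprime to its X-derivative: u R_j + w R_j' = H_j(Y) <> 0. Where
   H_j(y) <> 0 for all j, the solutions are finitely many, and differentiating
   R_j(g(z), z_j) = 0 along a kernel vector v of the Jacobian gives
   R_j'(y, z_j) v_j = 0, hence v = 0. *)

(** * Monomials and jets on the torus *)

Definition torus (F : fieldType) n (z : 'cV[F]_n) := forall k, z k 0 != 0.

Section Monomials.
Variables (F : fieldType) (n : nat).
Implicit Types (z : 'cV[F]_n) (a b : pt n).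

Lemma mon0 z : mon z 0 = 1.
Proof. by rewrite /mon big1 // => k _; rewrite mxE expr0z. Qed.

Lemma monD z a b : torus z -> mon z (a + b) = mon z a * mon z b.
Proof.
by move=> tz; rewrite /mon -big_split; apply: eq_bigr => k _; rewrite mxE expfzDr.
Qed.

Lemma monN z a : mon z (- a) = (mon z a)^-1.
Proof.
rewrite /mon -prodfV; apply: eq_bigr => k _; by rewrite mxE invr_expz.
Qed.

Lemma mon_neq0 z a : torus z -> mon z a != 0.
Proof. by move=> tz; apply/prodf_neq0 => k _; rewrite expfz_neq0. Qed.

Lemma mon_delta z k : mon z (delta_mx k 0) = z k 0.
Proof.
rewrite /mon (bigD1 k) //= big1 ?mulr1 ?mxE ?eqxx ?expr1z // => i ik.
by rewrite mxE (negPf ik) expr0z.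
Qed.

Lemma mon_map (F' : fieldType) (f : {rmorphism F -> F'}) z a :
  mon (map_mx f z) a = f (mon z a).
Proof.
rewrite /mon rmorph_prod; apply: eq_bigr => k _; rewrite mxE.
exact/esym/(fmorphXz f).
Qed.

Lemma monZ (c z : 'cV[F]_n) a :
  mon (\col_k (c k 0 * z k 0)) a = mon c a * mon z a.
Proof. by rewrite /mon -big_split; apply: eq_bigr => k _; rewrite mxE expfzMl. Qed.

End Monomials.

(** A nonzero polynomial has fewer than [size p] roots, while [f] supplies [size p] distinct values.
    This is the tool for choosing parameters that avoid finitely many bad ones. *)
Lemma poly_nonroot_seq (D : idomainType) (f : nat -> D) (p : {poly D}) :
  injective f -> p != 0 -> exists m, p.[f m] != 0.
Proof.
move=> finj p0; pose s := [seq f i | i <- iota 0 (size p)].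
have us : uniq s by rewrite map_inj_uniq // iota_uniq.
case: (boolP (all (root p) s)) => [ar|/allPn[x /mapP[m _ ->] h]]; last by exists m.
by have := max_poly_roots p0 ar us; rewrite size_map size_iota ltnn.
Qed.

Section Jets.
Variables (K : numClosedFieldType) (n : nat).
Implicit Types (z v : 'cV[K]_n) (A B : 'cV[K]_n -> K).

(* [A] restricted to the line z + s v is the rational function p/q of s, whose
   first order expansion at s = 0 is a + b s. *)
Definition jet z v A (a b : K) := exists p q : {poly K},
  [/\ q.[0] != 0, p.[0] = a * q.[0], p^`().[0] = b * q.[0] + a * q^`().[0]
    & forall s, torus (z + s *: v) -> A (z + s *: v) * q.[s] = p.[s]].

Lemma jetC z v c : jet z v (fun=> c) c 0.
Proof.
exists c%:P, 1; rewrite derivC -[1]/(1%:P) derivC !hornerC.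
by split; rewrite ?oner_neq0 ?mulr1 ?mulr0 ?mul0r ?addr0 // => s _; rewrite !hornerC mulr1.
Qed.

Lemma jet_coord z v k : jet z v (fun x => x k 0) (z k 0) (v k 0).
Proof.
exists ((z k 0)%:P + v k 0 *: 'X), 1; rewrite -[1]/(1%:P).
split.
- by rewrite hornerC oner_neq0.
- by rewrite !hornerE.
- by rewrite derivD derivZ !derivC derivX !hornerE.
- by move=> s _; rewrite !hornerE !mxE [s * _]mulrC.
Qed.

Lemma jetD z v A B a b a' b' : jet z v A a b -> jet z v B a' b' ->
  jet z v (fun x => A x + B x) (a + a') (b + b').
Proof.
case=> p [q [q0 p0 d0 e]] [p' [q' [q'0 p'0 d'0 e']]].
exists (p * q' + p' * q), (q * q'); split.
- by rewrite hornerM mulf_neq0.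
- by rewrite !(hornerD, hornerM) p0 p'0; ring.
- by rewrite derivD !derivM !(hornerD, hornerM) p0 p'0 d0 d'0; ring.
- by move=> s ts; rewrite !(hornerD, hornerM) -(e s) // -(e' s) //; ring.
Qed.

Lemma jetM z v A B a b a' b' : jet z v A a b -> jet z v B a' b' ->
  jet z v (fun x => A x * B x) (a * a') (b * a' + a * b').
Proof.
case=> p [q [q0 p0 d0 e]] [p' [q' [q'0 p'0 d'0 e']]].
exists (p * p'), (q * q'); split.
- by rewrite hornerM mulf_neq0.
- by rewrite !(hornerD, hornerM) p0 p'0; ring.
- by rewrite !derivM !(hornerD, hornerM) p0 p'0 d0 d'0; ring.
- by move=> s ts; rewrite !(hornerD, hornerM) -(e s) // -(e' s) //; ring.
Qed.

Lemma jetV z v A a b : (forall x, torus x -> A x != 0) -> a != 0 ->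
  jet z v A a b -> jet z v (fun x => (A x)^-1) a^-1 (- b / a ^+ 2).
Proof.
move=> A0 a0 [p [q [q0 p0 d0 e]]]; exists q, p; split.
- by rewrite p0 mulf_neq0.
- by rewrite p0 mulrA mulVf ?mul1r.
- by rewrite p0 d0; field.
- by move=> s ts; rewrite -e // mulKf ?A0.
Qed.

Lemma eq_jet z v A B a b : (forall x, torus x -> A x = B x) ->
  jet z v A a b -> jet z v B a b.
Proof.
move=> AB [p [q [h1 h2 h3 h4]]]; exists p, q; split=> // s ts.
by rewrite -AB // h4.
Qed.

Lemma jet_sum (I : Type) (r : seq I) (P : pred I) z v (A : I -> 'cV[K]_n -> K)
    (a b : I -> K) : (forall i, P i -> jet z v (A i) (a i) (b i)) ->
  jet z v (fun x => \sum_(i <- r | P i) A i x)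
    (\sum_(i <- r | P i) a i) (\sum_(i <- r | P i) b i).
Proof.
move=> h; elim: r => [|i r IH].
  by rewrite !big_nil; apply: eq_jet (jetC _ _ _) => x _; rewrite big_nil.
rewrite !big_cons; case: (boolP (P i)) => [Pi|nPi].
  apply: eq_jet (jetD (h _ Pi) IH) => x _; by rewrite big_cons Pi.
by apply: eq_jet IH => x _; rewrite big_cons (negPf nPi).
Qed.

Lemma jetMl z v A c a b : jet z v A a b -> jet z v (fun x => c * A x) (c * a) (c * b).
Proof. by move=> /(jetM (jetC z v c)); rewrite mul0r add0r. Qed.

(** Writing the slope as value times logarithmic derivative [b] makes a power multiply [b] by [m],
    uniformly in [m], including [m = 0]. *)
Lemma jetX z v A a b m : jet z v A a (a * b) ->
  jet z v (fun x => A x ^+ m) (a ^+ m) (a ^+ m * (m%:R * b)).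
Proof.
move=> jA; elim: m => [|m IH].
  by rewrite expr0 mul0r mulr0; apply: eq_jet (jetC _ _ _) => x _; rewrite expr0.
have := jetM jA IH; rewrite -exprS.
rewrite (_ : _ + _ = a ^+ m.+1 * (m.+1%:R * b)); last by rewrite !exprS -natr1; ring.
by apply: eq_jet => x _; rewrite exprS.
Qed.

Lemma jet_coordXz z v k (e : int) : torus z ->
  jet z v (fun x => x k 0 ^ e) (z k 0 ^ e) (z k 0 ^ e * (e%:~R * (v k 0 / z k 0))).
Proof.
move=> tz; have z0 := tz k.
have jk : jet z v (fun x => x k 0) (z k 0) (z k 0 * (v k 0 / z k 0)).
  by rewrite mulrCA mulfV // mulr1; exact: jet_coord.
case: e => m; first exact: jetX.
have := jetV _ _ (jetX m.+1 jk); rewrite NegzE.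
rewrite (_ : _ / _ = z k 0 ^ (- (m.+1%:Z)) * ((- (m.+1)%:Z)%:~R * (v k 0 / z k 0))).
  by apply=> [x tx|]; apply: expf_neq0 => //; exact: tx.
rewrite -exprnN rmorphN /= -pmulrn; field.
by rewrite z0 expf_neq0.
Qed.

Lemma jet_mon z v (e : pt n) : torus z ->
  jet z v (fun x => mon x e) (mon z e) (mon z e * \sum_k (e k 0)%:~R * (v k 0 / z k 0)).
Proof.
move=> tz; rewrite /mon; elim: (index_enum _) => [|k r IH].
  by rewrite !big_nil mulr0; apply: eq_jet (jetC _ _ _) => x _; rewrite big_nil.
rewrite !big_cons.
have := jetM (jet_coordXz v k (e k 0) tz) IH.
rewrite (_ : _ + _ = z k 0 ^ e k 0 * \prod_(j <- r) z j 0 ^ e j 0 *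
  ((e k 0)%:~R * (v k 0 / z k 0) + \sum_(j <- r) (e j 0)%:~R * (v j 0 / z j 0))).
  by apply: eq_jet => x _; rewrite big_cons.
ring.
Qed.

(** Its roots are the parameters [s] at which z + s v leaves the torus. *)
Definition linetorus z v : {poly K} := \prod_k ((z k 0)%:P + v k 0 *: 'X).

Lemma linetorusP z v s : (linetorus z v).[s] != 0 -> torus (z + s *: v).
Proof.
rewrite horner_prod => /prodf_neq0 h k; have := h k isT.
by rewrite !hornerE !mxE mulrC.
Qed.

Lemma linetorus_neq0 z v : torus z -> linetorus z v != 0.
Proof.
move=> tz; have : (linetorus z v).[0] != 0.
  by rewrite horner_prod; apply/prodf_neq0 => k _; rewrite !hornerE; exact: tz.
by apply: contraNneq => ->; rewrite horner0.
Qed.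

Lemma natr_injK : injective (fun m : nat => m%:R : K).
Proof. by move=> i j /eqP; rewrite eqr_nat => /eqP. Qed.

(** The numerator [p] times [linetorus] vanishes at every natural number, so [p] is zero; [q.[0] !=
    0] then kills both coefficients. *)
Lemma jet_eq0 z v A a b : torus z -> (forall x, torus x -> A x = 0) ->
  jet z v A a b -> a = 0 /\ b = 0.
Proof.
move=> tz A0 [p [q [q0 p0 d0 e]]].
have p_eq0 : p = 0.
  apply/eqP; apply: contraTT isT => np0.
  have := mulf_neq0 np0 (linetorus_neq0 v tz).
  case/(poly_nonroot_seq natr_injK) => m; rewrite hornerM mulf_eq0 negb_or.
  by case/andP=> pm /linetorusP tm; rewrite -e // A0 // mul0r eqxx in pm.
have a0 : a = 0.
  by apply/eqP; move/eqP: p0; rewrite p_eq0 horner0 eq_sym mulf_eq0 (negPf q0) orbF.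
split=> //; apply/eqP; move/eqP: d0.
by rewrite p_eq0 a0 mul0r addr0 deriv0 horner0 eq_sym mulf_eq0 (negPf q0) orbF.
Qed.

Definition regular A := forall z v, torus z -> exists b, jet z v A (A z) b.

(* On the line through two points where A and B do not vanish, both are nonzero
   rational functions of one parameter. *)
Lemma regular_domain A B : regular A -> regular B ->
  (forall x, torus x -> A x * B x = 0) ->
  (exists2 x, torus x & A x != 0) -> forall x, torus x -> B x = 0.
Proof.
move=> rA rB AB [z1 t1 A1] z2 t2; apply/eqP; apply: contraTT isT => B2.
have [b [p [q [q0 p0 _ e]]]] := rA z1 (z2 - z1) t1.
have [b' [p' [q' [q'0 p'0 _ e']]]] := rB z2 (z1 - z2) t2.
(* One line is parametrized from both ends: the point of parameter s seen from [z1] has parameter 1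
   - s seen from [z2]. *)
pose l : {poly K} := 1 - 'X.
have pn0 : p != 0.
  have : p.[0] != 0 by rewrite p0 mulf_neq0.
  by apply: contraNneq => ->; rewrite horner0.
have p'n0 : p' \Po l != 0.
  have : (p' \Po l).[1] != 0 by rewrite horner_comp !hornerE subrr p'0 mulf_neq0.
  by apply: contraNneq => ->; rewrite horner0.
have := mulf_neq0 (mulf_neq0 pn0 p'n0) (linetorus_neq0 (z2 - z1) t1).
case/(poly_nonroot_seq natr_injK) => m; rewrite !hornerM !mulf_eq0 !negb_or.
case/andP=> /andP[pm p'm] /linetorusP tm.
have eq12 : z2 + (1 - m%:R) *: (z1 - z2) = z1 + m%:R *: (z2 - z1).
  by apply/matrixP => i j; rewrite !mxE; ring.
have := e _ tm; move: (e' (1 - m%:R)); rewrite eq12 => /(_ tm) E' E.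
move: p'm; rewrite horner_comp !hornerE -E' => p'm; move: pm; rewrite -E => pm.
have := mulf_neq0 pm p'm.
rewrite mulrACA AB // mul0r eqxx => //.
Qed.

End Jets.

(** * Generic Laurent systems *)

Lemma size_deriv_eq0 (D : idomainType) (p : {poly D}) :
  (forall m : nat, m.+1%:R != 0 :> D) -> p^`() = 0 -> (size p <= 1)%N.
Proof.
move=> D0 p'0; rewrite leqNgt; apply/negP => sp.
have := congr1 (fun q : {poly D} => q`_(size p).-2) p'0.
rewrite coef_deriv coef0 -mulr_natr.
have p0 : p != 0 by rewrite -size_poly_eq0; case: (size p) sp.
case: (size p) (lead_coefE p) sp => [|[|m]] //= e _.
by move/eqP; rewrite -e mulf_eq0 lead_coef_eq0 (negPf (D0 _)) orbF (negPf p0).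
Qed.

Module Genericity.
Import mpoly.

(** * Algebraic relations between the g_i and one coordinate *)

Section Relations.
Variables (K : numClosedFieldType) (n : nat).
Implicit Types (h : {mpoly K[n]}) (R Q : {poly {mpoly K[n]}}).

(** R(Y, X) is stored as a polynomial in X over the polynomials in Y, so that gcds and derivatives
    are taken in X. *)
Definition ev R (y : 'I_n -> K) (x : K) := (map_poly (meval y) R).[x].

Lemma evM R Q y x : ev (R * Q) y x = ev R y x * ev Q y x.
Proof. by rewrite /ev rmorphM hornerM. Qed.

Lemma evD R Q y x : ev (R + Q) y x = ev R y x + ev Q y x.
Proof. by rewrite /ev rmorphD hornerD. Qed.

Lemma evC h y x : ev h%:P y x = h.@[y].
Proof. by rewrite /ev map_polyC hornerC. Qed.

Lemma evX y x : ev 'X y x = x.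
Proof. by rewrite /ev map_polyX hornerX. Qed.

Variable (g : 'I_n -> 'cV[K]_n -> K).
Local Notation G := (fun z i => g i z).

Section AtPoint.
Variables (z v : 'cV[K]_n) (b : 'I_n -> K).
Hypothesis jg : forall i, jet z v (g i) (g i z) (b i).

Let J (A : 'cV[K]_n -> K) :=
  exists c, jet z v A (A z) c /\ ((forall i, b i = 0) -> c = 0).

Let JC c : J (fun=> c).
Proof. by exists 0; split=> //; exact: jetC. Qed.

Let JD A B : J A -> J B -> J (fun x => A x + B x).
Proof.
case=> c [j1 e1] [d [j2 e2]]; exists (c + d); split; first exact: jetD.
by move=> b0; rewrite e1 // e2 // addr0.
Qed.

Let JM A B : J A -> J B -> J (fun x => A x * B x).
Proof.
case=> c [j1 e1] [d [j2 e2]]; exists (c * B z + A z * d); split; first exact: jetM.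
by move=> b0; rewrite e1 // e2 // mulr0 mul0r addr0.
Qed.

Let Jeq A B : (forall x, A x = B x) -> J A -> J B.
Proof.
move=> AB [c [j e]]; exists c; split=> //; rewrite -AB.
by apply: eq_jet j => x _.
Qed.

(** A weak chain rule: of the slope, only its vanishing when all slopes [b i] vanish is recorded.
    This property passes through sums and products. *)
Lemma jet_meval h : exists c, jet z v (fun x => h.@[G x]) h.@[G z] c /\
  ((forall i, b i = 0) -> c = 0).
Proof.
rewrite -/(J (fun x => h.@[G x])); elim/mpolyind: h => [|c m h _ _ IH].
  by apply: Jeq (JC 0) => x; rewrite meval0.
suff Jm : J (fun x => 'X_[m].@[G x]).
  by apply: Jeq (JD (JM (JC c) Jm) IH) => x; rewrite mevalD mevalZ.
have Jp k : J (fun x => \prod_(i <- k) g i x ^+ m i).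
  elim: k => [|i k IHk]; first by apply: Jeq (JC 1) => x; rewrite big_nil.
  suff Ji : J (fun x => g i x ^+ m i).
    by apply: Jeq (JM Ji IHk) => x; rewrite big_cons.
  elim: (m i) => [|d IHd]; first by apply: Jeq (JC 1) => x; rewrite expr0.
  have Ji : J (g i) by exists (b i).
  by apply: Jeq (JM Ji IHd) => x; rewrite exprS.
by apply: Jeq (Jp _) => x; rewrite mevalX.
Qed.

(** When the slopes of all [g i] vanish, R(g(z), z_j) varies to first order only through z_j, which
    leaves the X-derivative. *)
Lemma jet_ev R j : exists c,
  jet z v (fun x => ev R (G x) (x j 0)) (ev R (G z) (z j 0)) c /\
  ((forall i, b i = 0) -> c = ev R^`() (G z) (z j 0) * v j 0).
Proof.
elim/poly_ind: R => [|R h [c [jR eR]]].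
  exists 0; split; last by rewrite deriv0 /ev rmorph0 horner0 mul0r.
  have ev0 x : ev 0 (G x) (x j 0) = 0 by rewrite /ev rmorph0 horner0.
  by rewrite ev0; apply: eq_jet (jetC z v 0) => x _; rewrite ev0.
have [d [jh eh]] := jet_meval h.
have E x : ev (R * 'X + h%:P) (G x) (x j 0) = ev R (G x) (x j 0) * x j 0 + h.@[G x].
  by rewrite evD evM evX evC.
exists (c * z j 0 + ev R (G z) (z j 0) * v j 0 + d); split.
  rewrite E; apply: eq_jet (jetD (jetM jR (jet_coord z v j)) jh) => x _.
  by rewrite E.
move=> b0; rewrite eR // eh // derivD derivM derivX derivC !addr0 mulr1 evD evM evX.
by ring.
Qed.

End AtPoint.

Hypothesis rg : forall i, regular (g i).

Lemma regular_ev R j : regular (fun x => ev R (G x) (x j 0)).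
Proof.
move=> z v tz; have [b jb] := boolp.choice (fun i => rg i v tz).
by have [c [jc _]] := jet_ev jb R j; exists c.
Qed.

Definition relation j R :=
  forall z : 'cV[K]_n, torus z -> ev R (G z) (z j 0) = 0.

(** Functions of the form R(g(z), z_j) have no zero divisors on the torus, by [regular_domain]. *)
Lemma relationM j R Q : relation j (R * Q) -> relation j R \/ relation j Q.
Proof.
move=> rRQ; case: (boolp.EM (relation j R)) => [|nR]; [by left|right].
apply: (regular_domain (regular_ev R j) (regular_ev Q j)).
  by move=> x tx; rewrite -evM rRQ.
apply: boolp.contrapT => h; apply: nR => z tz.
by apply: boolp.contrapT => /eqP h'; apply: h; exists z.
Qed.

(* A nonconstant common factor of R and R' or its cofactor in R is again a
   relation, of smaller degree. *)
Lemma separable_relation j R : R != 0 -> relation j R ->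
  exists (H : {mpoly K[n]}) (R u w : {poly {mpoly K[n]}}),
    [/\ H != 0, relation j R & H%:P = u * R + w * R^`()].
Proof.
have [N] := ubnP (size R); elim: N R => // N IH R sR R0 rR.
case: (boolP (coprimep R R^`())) => [/Bezout_coprimepP[[u w] /= e]|nco].
  have : size (u * R + w * R^`()) == 1%N by rewrite (eqp_size e) size_poly1.
  case/size_poly1P => H H0 eH; exists H, R, u, w; split=> //.
set d := gcdp R R^`() in nco.
have d0 : d != 0 by rewrite gcdp_eq0 (negPf R0).
have sd : (1 < size d)%N.
  rewrite coprimep_def in nco; have := nco; rewrite -/d -size_poly_eq0 in d0 *.
  by case: (size d) d0 => [|[]].
(* If the derivative vanished, [d] would be [R], of size at most 1 in characteristic zero. *)
have R'0 : R^`() != 0.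
  apply: contraTneq sd => R'0; rewrite /d R'0 gcdp0.
  rewrite -leqNgt; apply: size_deriv_eq0 R'0 => m.
  by rewrite -[_%:R](rmorph_nat (@mpolyC n K)) mpolyC_eq0 pnatr_eq0.
have sdR : (size d < size R)%N.
  by apply: leq_ltn_trans (leq_gcdpr _ R'0) (lt_size_deriv R0).
(* The coefficients form a domain and not a field, so [d] divides [R] only up to a nonzero scalar
   [c]. *)
have /Pdiv.WeakIdomain.dvdpP[[c q] /= c0 e] := dvdp_gcdl R R^`().
have q0 : q != 0.
  apply/negP => /eqP q0; move/eqP: e.
  by rewrite q0 mul0r -mul_polyC mulf_eq0 polyC_eq0 (negPf c0) (negPf R0).
have sq : (size q < size R)%N.
  have := congr1 (fun p : {poly _} => size p) e; rewrite size_scale // -/d size_mul //.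
  by move=> ->; case: (size d) sd => [|[|k]] // _; rewrite addnS /= addnS ltnS leq_addr.
have /relationM[rq|rd] : relation j (q * d).
- by move=> z tz; rewrite -e -mul_polyC evM rR // mulr0.
- by apply: (IH q) => //; apply: leq_trans sq _.
- by apply: (IH d) => //; apply: leq_trans sdR _.
Qed.

End Relations.

(** * Laurent polynomials of bounded degree *)

Section Laurent.
Variables (K : fieldType) (n : nat).
Implicit Types (A B : 'cV[K]_n -> K).

(* The exponents in [-D, D]^n, indexed by finite functions shifted by D. *)
Definition expo D (f : {ffun 'I_n -> 'I_D.*2.+1}) : pt n :=
  \col_k ((f k)%:Z - D%:Z).

Definition laurent D A := exists g : {ffun 'I_n -> 'I_D.*2.+1} -> K,
  forall z, torus z -> A z = \sum_f g f * mon z (expo f).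

Lemma expo_surj D (a : pt n) : (forall k, `|a k 0| <= D%:Z) -> exists f, a = expo (D := D) f.
Proof.
move=> aD; have lt_aD k : (absz (a k 0 + D%:Z)%R < D.*2.+1)%N.
  by move: (aD k); lia.
exists [ffun k => Ordinal (lt_aD k)]; apply/matrixP => k j.
by rewrite ord1 !mxE ffunE /=; move: (aD k); lia.
Qed.

Lemma laurent_mon D (a : pt n) : (forall k, `|a k 0| <= D%:Z) ->
  laurent D (fun z => mon z a).
Proof.
move=> /expo_surj[f ->]; exists (fun f' => (f' == f)%:R) => z tz.
rewrite (bigD1 f) //= eqxx mul1r big1 ?addr0 // => f' /negPf ->.
by rewrite mul0r.
Qed.

Lemma laurentD D A B : laurent D A -> laurent D B -> laurent D (fun z => A z + B z).
Proof.
case=> g eA [h eB]; exists (fun f => g f + h f) => z tz.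
by rewrite eA // eB // -big_split; apply: eq_bigr => f _; rewrite mulrDl.
Qed.

Lemma laurentZ D c A : laurent D A -> laurent D (fun z => c * A z).
Proof.
case=> g eA; exists (fun f => c * g f) => z tz.
by rewrite eA // mulr_sumr; apply: eq_bigr => f _; rewrite mulrA.
Qed.

Lemma laurent0 D : laurent D (fun=> 0).
Proof.
by exists (fun=> 0) => z _; rewrite big1 // => f _; rewrite mul0r.
Qed.

Lemma eq_laurent D A B : (forall z, torus z -> A z = B z) -> laurent D A -> laurent D B.
Proof. by move=> AB [g e]; exists g => z tz; rewrite -AB // e. Qed.

Lemma laurent_sum (I : Type) (r : seq I) D (A : I -> 'cV[K]_n -> K) :
  (forall i, laurent D (A i)) -> laurent D (fun z => \sum_(i <- r) A i z).
Proof.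
move=> lA; elim: r => [|i r IH].
  by apply: eq_laurent (laurent0 D) => z _; rewrite big_nil.
by apply: eq_laurent (laurentD (lA i) IH) => z _; rewrite big_cons.
Qed.

Lemma expo_bound D (f : {ffun 'I_n -> 'I_D.*2.+1}) k : `|expo f k 0| <= D%:Z.
Proof. by rewrite mxE; have := ltn_ord (f k); lia. Qed.

Lemma laurentM D E A B : laurent D A -> laurent E B ->
  laurent (D + E) (fun z => A z * B z).
Proof.
case=> g eA [h eB].
suff l : laurent (D + E) (fun z => \sum_f g f * \sum_e h e * mon z (expo f + expo e)).
  apply: eq_laurent l => z tz; rewrite eA // eB // mulr_suml.
  apply: eq_bigr => f _; rewrite -mulrA; congr (_ * _); rewrite mulr_sumr.
  by apply: eq_bigr => e _; rewrite monD //; ring.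
apply: laurent_sum => f; apply: laurentZ; apply: laurent_sum => e; apply: laurentZ.
apply: laurent_mon => k; rewrite mxE.
by rewrite PoszD (le_trans (ler_normD _ _)) // lerD // expo_bound.
Qed.

Lemma laurent_leq D E A : (D <= E)%N -> laurent D A -> laurent E A.
Proof.
move=> DE [g eA].
suff l : laurent E (fun z => \sum_f g f * mon z (expo f)).
  by apply: eq_laurent l => z tz; rewrite eA.
apply: laurent_sum => f; apply: laurentZ; apply: laurent_mon => k.
by rewrite (le_trans (expo_bound _ _)).
Qed.

Lemma laurentX D A m : laurent D A -> laurent (m * D) (fun z => A z ^+ m).
Proof.
move=> lA; elim: m => [|m IH].
  apply: eq_laurent (laurent_mon (a := 0) _) => [z _|k]; first by rewrite mon0 expr0.
  by rewrite mxE normr0.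
by rewrite mulSn; apply: eq_laurent (laurentM lA IH) => z _; rewrite exprS.
Qed.

Lemma laurent_prod (I : Type) (r : seq I) D (A : I -> 'cV[K]_n -> K) :
  (forall i, laurent D (A i)) -> laurent (size r * D) (fun z => \prod_(i <- r) A i z).
Proof.
move=> lA; elim: r => [|i r IH].
  apply: eq_laurent (laurent_mon (a := 0) _) => [z _|k]; first by rewrite mon0 big_nil.
  by rewrite mxE normr0.
by rewrite mulSn; apply: eq_laurent (laurentM (lA i) IH) => z _; rewrite big_cons.
Qed.

Lemma laurent_ex_mon (a : pt n) : exists D, laurent D (fun z => mon z a).
Proof.
exists (\max_k absz (a k ord0))%N; apply: laurent_mon => k.
by rewrite -abszE lez_nat; exact: (leq_bigmax (F := fun k : 'I_n => absz (a k 0))).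
Qed.

(** Exponents in the box number (2D+1)^n, so the coefficient matrix of a larger family has a nonzero
    left kernel vector. *)
Lemma laurent_dependent (T : finType) D (A : T -> 'cV[K]_n -> K) :
  (forall t, laurent D (A t)) -> (D.*2.+1 ^ n < #|T|)%N ->
  exists2 r : T -> K, (exists t, r t != 0) &
    forall z, torus z -> \sum_t r t * A t z = 0.
Proof.
move=> lA cT; have [g gA] := boolp.choice lA.
pose U := {ffun 'I_n -> 'I_D.*2.+1}.
pose M : 'M[K]_(#|T|, #|U|) := \matrix_(i, j) g (enum_val i) (enum_val j).
have kM : kermx M != 0.
  rewrite kermx_eq0 /row_free; apply: contraTneq cT => <-.
  by rewrite -leqNgt (leq_trans (rank_leq_col M)) // card_ffun !card_ord.
have [i ri] : exists i, row i (kermx M) != 0.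
  apply: boolp.contrapT => h; move/eqP: kM; apply; apply/row_matrixP => i.
  by rewrite row0; apply: boolp.contrapT => /eqP h'; apply: h; exists i.
have [r r0 rM] : exists2 r : 'rV_#|T|, r != 0 & r *m M = 0.
  by exists (row i (kermx M)); rewrite // -row_mul mulmx_ker row0.
exists (fun t => r 0 (enum_rank t)).
  apply: boolp.contrapT => h; move/eqP: r0; apply; apply/rowP => j; rewrite [RHS]mxE.
  apply: boolp.contrapT => /eqP h'; apply: h; exists (enum_val j).
  by rewrite enum_valK.
move=> z tz.
transitivity (\sum_f (\sum_t r 0 (enum_rank t) * g t f) * mon z (expo f)).
  transitivity (\sum_t \sum_f r 0 (enum_rank t) * g t f * mon z (expo f)).
    apply: eq_bigr => t _; rewrite gA // mulr_sumr.
    by apply: eq_bigr => f _; rewrite mulrA.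
  by rewrite exchange_big; apply: eq_bigr => f _; rewrite mulr_suml.
apply: big1 => f _; suff -> : \sum_t r 0 (enum_rank t) * g t f = 0 by rewrite mul0r.
transitivity ((r *m M) 0 (enum_rank f)); last by rewrite rM mxE.
rewrite mxE (reindex enum_rank) /=; last exact: onW_bij (enum_rank_bij T).
by apply: eq_bigr => t _; rewrite mxE !enum_rankK.
Qed.

End Laurent.

Section Existence.
Variables (K : numClosedFieldType) (n : nat) (g : 'I_n -> 'cV[K]_n -> K).

(* The N^(n+1) products of powers < N of the g_i and of z_j involve O(N^n)
   exponents only. *)
Lemma relation_exists j : (exists D, forall i, laurent D (g i)) ->
  exists2 R : {poly {mpoly K[n]}}, R != 0 & relation g j R.
Proof.
(* The products have degree at most N(nD+1) = NC, hence at most (2NC+1)^n exponents. This is at most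
   N^n (2C+1)^n, and [N] exceeds (2C+1)^n, so the N^(n+1) products are dependent. *)
case=> D lg; pose C := (n * D + 1)%N; pose N := ((C.*2.+1) ^ n).+1.
pose T := ({ffun 'I_n -> 'I_N} * 'I_N)%type.
pose A (t : T) (z : 'cV[K]_n) := \prod_i g i z ^+ t.1 i * z j 0 ^+ t.2.
have lA t : laurent (N * C) (A t).
  have lz : laurent 1 (fun z : 'cV[K]_n => z j 0).
    apply: eq_laurent (laurent_mon K (a := delta_mx j 0) _) => [z _|k].
      by rewrite mon_delta.
    by rewrite mxE; case: (_ && _).
  have lp i : laurent (N * D) (fun z => g i z ^+ t.1 i).
    by apply: laurent_leq (laurentX (t.1 i) (lg i)); rewrite leq_mul2r ltnW ?orbT.
  have := laurentM (laurent_prod (enum 'I_n) lp) (laurentX t.2 lz).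
  rewrite size_enum_ord muln1 => l.
  apply: (@laurent_leq _ _ (n * (N * D) + t.2)).
    by rewrite /C mulnDr muln1 mulnCA leq_add2l ltnW.
  by apply: eq_laurent l => z _; rewrite big_enum.
have cT : ((N * C).*2.+1 ^ n < #|{: T}|)%N.
  rewrite card_prod card_ffun !card_ord.
  apply: (@leq_ltn_trans ((N * C.*2.+1) ^ n)).
    by case: (n) => // m; rewrite leq_exp2r // mulnS -doubleMr -addn1 addnC leq_add2r.
  by rewrite expnMn ltn_pmul2l ?expn_gt0.
have [r [t0 rt0] rA] := laurent_dependent lA cT.
pose mn (f : {ffun 'I_n -> 'I_N}) : 'X_{1..n} := [multinom (f i : nat) | i < n].
have mn_inj : injective mn.
  move=> f f' /mnmP e; apply/ffunP => i; apply/val_inj.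
  by have := e i; rewrite !mnmE.
pose R := \poly_(b < N) \sum_(f : {ffun 'I_n -> 'I_N}) r (f, inord b) *: 'X_[mn f] : {poly {mpoly K[n]}}.
exists R.
  (* The exponents [mn f] are distinct, so the coefficient of [R] at the index [t0] is [r t0]
     itself. *)
  apply: contra rt0 => /eqP R0; case: t0 => f0 b0.
  have := congr1 (fun p : {poly {mpoly K[n]}} => mcoeff (mn f0) p`_b0) R0.
  rewrite coef_poly ltn_ord coef0 mcoeff0 raddf_sum /= (bigD1 f0) //= inord_val.
  rewrite mcoeffZ mcoeffX eqxx mulr1 big1 ?addr0 => [->//|f nf].
  by rewrite mcoeffZ mcoeffX (inj_eq mn_inj) (negPf nf) mulr0.
move=> z tz; rewrite -[RHS](rA z tz) /ev.
have -> : map_poly (meval (fun i => g i z)) R =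
    \poly_(b < N) \sum_(f : {ffun 'I_n -> 'I_N}) r (f, inord b) * \prod_i g i z ^+ f i.
  apply/polyP => b; rewrite coef_map !coef_poly; case: ifP => _; last by rewrite raddf0.
  rewrite raddf_sum; apply: eq_bigr => f _; rewrite /= mevalZ mevalX.
  by congr (_ * _); apply: eq_bigr => i _; rewrite mnmE.
have -> : \sum_t r t * A t z = \sum_f \sum_b r (f, b) * A (f, b) z.
  by rewrite pair_bigA; apply: eq_bigr => -[].
rewrite horner_poly exchange_big.
apply: eq_bigr => b _; rewrite mulr_suml; apply: eq_bigr => f _.
by rewrite inord_val /A mulrA.
Qed.

End Existence.

(** * Finiteness and simplicity for generic perturbations *)

Section Generic.
Variables (K : numClosedFieldType) (n : nat).

Lemma seq_of_coords (r : 'I_n -> seq K) : exists s : seq 'cV[K]_n,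
  forall z : 'cV[K]_n, (forall j, z j 0 \in r j) -> z \in s.
Proof.
pose N := (\max_j size (r j))%N.
exists [seq \col_k (r k)`_(f k) | f : {ffun 'I_n -> 'I_N.+1}] => z zr.
have lt_i k : (index (z k ord0) (r k) < N.+1)%N.
  rewrite ltnS (leq_trans (index_size _ _)) //.
  exact: (leq_bigmax (F := fun k => size (r k))).
apply/mapP; exists [ffun k => Ordinal (lt_i k)]; first by rewrite mem_enum.
by apply/matrixP => i j; rewrite ord1 mxE ffunE /= nth_index.
Qed.

(* Logarithmic derivative at z, along v, of the monomial with exponent a. *)
Definition dlog (z v : 'cV[K]_n) (a : pt n) : K :=
  \sum_k (a k 0)%:~R * (v k 0 / z k 0).

Lemma dlogN z v a : dlog z v (- a) = - dlog z v a.
Proof.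
rewrite /dlog -sumrN; apply: eq_bigr => k _.
by rewrite mxE rmorphN mulNr.
Qed.

(* The last conclusion says that the Jacobian matrix at z is injective, with its
   columns scaled by logarithmic derivatives. *)
Lemma generic_system (S : seq (pt n)) (c : 'I_n -> pt n -> K) (a0 : pt n) :
  exists2 H : {mpoly K[n]}, H != 0 & forall y : 'I_n -> K, H.@[y] != 0 ->
    let sol z := torus z /\
      forall i, \sum_(a <- S) c i a * mon z a + y i * mon z a0 = 0 in
    (exists s : seq 'cV[K]_n, forall z, sol z -> z \in s) /\
    (forall z v, sol z ->
      (forall i, \sum_(a <- S) c i a * (mon z a * dlog z v a)
                 + y i * (mon z a0 * dlog z v a0) = 0) -> v = 0).
Proof.
pose g i (z : 'cV[K]_n) := - (\sum_(a <- S) c i a * mon z a) * mon z (- a0).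
have jg i z v : torus z -> jet z v (g i) (g i z)
    (- (\sum_(a <- S) c i a * (mon z a * dlog z v a)) * mon z (- a0)
     + - (\sum_(a <- S) c i a * mon z a) * (mon z (- a0) * dlog z v (- a0))).
  move=> tz; apply: jetM (jet_mon v (- a0) tz).
  have j0 : jet z v (fun x => \sum_(a <- S) c i a * mon x a)
      (\sum_(a <- S) c i a * mon z a) (\sum_(a <- S) c i a * (mon z a * dlog z v a)).
    by apply: jet_sum => a _; apply: jetMl; exact: jet_mon.
  rewrite -mulN1r -[X in jet _ _ _ _ X]mulN1r.
  by apply: eq_jet (jetMl (-1) j0) => x _; rewrite mulN1r.
have rg i : regular (g i) by move=> z v tz; eexists; exact: jg.
have lg : exists D, forall i, laurent D (g i).
  have [D lD] := boolp.choice (laurent_ex_mon K (n := n)).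
  pose E := (\max_(a <- S) D a)%N.
  exists (E + D (- a0))%N => i; apply: laurentM (lD _).
  have l : laurent E (fun z => \sum_(a <- S) c i a * mon z a).
    rewrite /E; elim: (S) => [|a s IH].
      by apply: eq_laurent (laurent0 K n _) => z _; rewrite big_nil.
    rewrite big_cons.
    have l1 := laurent_leq (leq_maxl (D a) (\max_(j <- s) D j)%N) (lD a).
    have l2 := laurent_leq (leq_maxr (D a) (\max_(j <- s) D j)%N) IH.
    by apply: eq_laurent (laurentD (laurentZ (c i a) l1) l2) => z _; rewrite big_cons.
  by apply: eq_laurent (laurentZ (-1) l) => z _; rewrite mulN1r.
have hR j : exists H : {mpoly K[n]}, H != 0 /\
    exists (R u w : {poly {mpoly K[n]}}),
    relation g j R /\ H%:P = u * R + w * R^`().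
  have [R R0 rR] := relation_exists j lg.
  have [H [R' [u [w [H0 rR' e]]]]] := separable_relation rg R0 rR.
  by exists H; split=> //; exists R', u, w.
have [H hHR] := boolp.choice hR.
have H0 j := (hHR j).1; have hH j := (hHR j).2.
exists (\prod_j H j); first by apply/prodf_neq0 => j _.
move=> y; rewrite rmorph_prod => /prodf_neq0 Hy sol.
have eqy z : sol z -> (fun i => g i z) =1 y.
  case=> tz ez i; have /eqP := ez i; rewrite addr_eq0 => /eqP e.
  by rewrite /g e opprK monN mulfK // mon_neq0.
have evy z R j : sol z -> ev R (fun i => g i z) (z j 0) = ev R y (z j 0).
  move=> sz; rewrite /ev; congr (_.[_]); apply/polyP => k; rewrite !coef_map /=.
  exact/meval_eq/eqy.
split.
  have hr j : exists r : seq K, forall z, sol z -> z j 0 \in r.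
    have [R [u [w [rR e]]]] := hH j.
    pose Ry := map_poly (meval y) R.
    (* If [R] specialized to zero at [y], so would its derivative, and the Bezout identity would
       give [(H j).@[y] = 0]. *)
    have Ry0 : Ry != 0.
      apply: contra (Hy j isT) => /eqP Ry0.
      have := congr1 (fun Q => ev Q y 0) e; rewrite evC evD !evM /ev -deriv_map.
      by rewrite -/Ry Ry0 deriv0 horner0 !mulr0 addr0 => e0; exact/eqP.
    have [r er] := closed_field_poly_normal Ry.
    exists r => z sz; have := rR z sz.1; rewrite evy // /ev -/Ry er hornerZ => /eqP.
    by rewrite mulf_eq0 lead_coef_eq0 (negPf Ry0) /= -rootE root_prod_XsubC.
  have [r rP] := boolp.choice hr; have [s sP] := seq_of_coords r.
  by exists s => z sz; apply: sP => j; exact: rP.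
move=> z v sz dz; have [tz ez] := sz; apply/colP => j; rewrite [RHS]mxE.
have [R [u [w [rR e]]]] := hH j.
have [b [jb eb]] := jet_ev (fun i => jg i z v tz) R j.
have [_ b0] := jet_eq0 tz rR jb.
have /eqP : ev R^`() (fun i => g i z) (z j 0) * v j 0 = 0.
  (* Substituting the equation [ez] and its differentiated form [dz] makes the two terms in the
     slope of [g i] cancel, because dlog at -a0 is minus dlog at a0. *)
  rewrite -eb // => i.
  have /eqP := ez i; rewrite addr_eq0 => /eqP ->.
  have /eqP := dz i; rewrite addr_eq0 => /eqP ->.
  by rewrite dlogN; ring.
rewrite mulf_eq0 => /orP[|/eqP//].
move=> /eqP R'0; have := congr1 (fun Q => ev Q (fun i => g i z) (z j 0)) e.
rewrite evC evD !evM R'0 rR // !mulr0 addr0 (meval_eq _ (eqy z sz)) => Hy0.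
by have /eqP := Hy j isT; case.
Qed.

Lemma horner_mmap (F : 'I_n -> {poly {mpoly K[n]}}) (a : {mpoly K[n]}) (h : {mpoly K[n]}) :
  (mmap (polyC \o @mpolyC n K) F h).[a] = mmap (@mpolyC n K) (fun k => (F k).[a]) h.
Proof.
rewrite /mmap horner_sum; apply: eq_bigr => m _; rewrite hornerM /= hornerC.
congr (_ * _); rewrite /mmap1 horner_prod; apply: eq_bigr => i _.
by rewrite horner_exp.
Qed.

(** The variables are specialized one after the other; each time a nonzero univariate polynomial
    over a domain must avoid its roots. *)
Lemma mpoly_nonroot (h : {mpoly K[n]}) (f : nat -> 'I_n -> K) :
  h != 0 -> (forall i, injective (f^~ i)) ->
  exists m : 'I_n -> nat, h.@[fun i => f (m i) i] != 0.
Proof.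
move=> h0 finj.
pose sub (s : seq 'I_n) (m : 'I_n -> nat) (i : 'I_n) : {mpoly K[n]} :=
  if i \in s then (f (m i) i)%:MP else 'X_i.
have [m hm] : exists m, mmap (@mpolyC n K) (sub (enum 'I_n) m) h != 0.
  have := enum_uniq 'I_n; elim: (enum 'I_n) => [_|i s IH /= /andP[nis us]].
    exists (fun=> 0%N); apply: contra h0 => /eqP e; apply/eqP.
    apply/mpolyP => k; rewrite mcoeff0.
    by rewrite -[h]comp_mpoly_id /comp_mpoly -[RHS](mcoeff0 K k) -e; congr (mcoeff _ _);
       apply: eq_bigr => l _; congr (_ * _); apply: eq_bigr => j _;
       rewrite tnth_map tnth_ord_tuple.
  have [m hm] := IH us.
  (* Variable [i] becomes the univariate indeterminate; the variables in [s] keep their chosen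
     values and the others stay formal. *)
  pose F k : {poly {mpoly K[n]}} := if k == i then 'X else (sub s m k)%:P.
  pose P := mmap (polyC \o @mpolyC n K) F h.
  have PX : P.['X_i] = mmap (@mpolyC n K) (sub s m) h.
    rewrite horner_mmap; congr (mmap _ _ _); apply: boolp.funext => k.
    rewrite /F; case: eqP => [->|_]; last by rewrite hornerC.
    by rewrite hornerX /sub (negPf nis).
  have P0 : P != 0 by apply: contraNneq hm => P0; rewrite -PX P0 horner0.
  have finjC : injective (fun k => (f k i)%:MP_[n]) by move=> k l /(can_inj (@mpolyCK n K)) /finj.
  have [k Pk] := poly_nonroot_seq finjC P0.
  exists (fun j => if j == i then k else m j).
  set F' := sub _ _; suff FF' : F' = fun j => (F j).[(f k i)%:MP].
    by rewrite FF' -horner_mmap.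
  apply: boolp.funext => j; rewrite /F /F' /sub in_cons.
  by case: eqP => [->|_] /=; rewrite ?hornerX ?hornerC.
exists m; apply: contra hm => /eqP e; apply/eqP.
rewrite -[RHS](mpolyC0 n K) -e mevalE rmorph_sum; apply: eq_bigr => k _.
rewrite rmorphM rmorph_prod; congr (_ * _); apply: eq_bigr => i _.
by rewrite rmorphXn /= /sub mem_enum.
Qed.

End Generic.
End Genericity.

(** * Lattice points, facets and moment matrices *)

Section Convexity.
Variable R : realType.

Lemma convR_mem k (X : seq 'cV[R]_k) x : x \in X -> convR X x.
Proof.
rewrite -index_mem => iX; exists (fun i => (i == Ordinal iX)%:R); split=> [i|].
  by rewrite ler0n.
split; rewrite (bigD1 (Ordinal iX)) //= eqxx big1 ?addr0 //.
- by move=> i /negPf ->.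
- by rewrite scale1r nth_index // -index_mem.
- by move=> i /negPf ->; rewrite scale0r.
Qed.

(** Only points of nonzero weight are asked to lie in the hull of [Y]; [lower_facet_vertex] relies
    on this form. *)
Lemma convR_comb k (X Y : seq 'cV[R]_k) (l : 'I_(size X) -> R) :
  (forall i, 0 <= l i) -> \sum_i l i = 1 ->
  (forall i, l i != 0 -> convR Y X`_i) -> convR Y (\sum_i l i *: X`_i).
Proof.
move=> l0 l1 XY.
have /boolp.choice[m mP] : forall i : 'I_(size X), exists m : 'I_(size Y) -> R,
    l i != 0 -> (forall j, 0 <= m j) /\ \sum_j m j = 1 /\ X`_i = \sum_j m j *: Y`_j.
  move=> i; case: (eqVneq (l i) 0) => [_|/XY[m hm]]; last by exists m.
  by exists (fun=> 0).
exists (fun j => \sum_i l i * m i j); split=> [j|].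
  rewrite sumr_ge0 // => i _; case: (eqVneq (l i) 0) => [->|/mP[m0 _]].
    by rewrite mul0r.
  by rewrite mulr_ge0.
split.
  rewrite exchange_big -[RHS]l1; apply: eq_bigr => i _; rewrite -mulr_sumr.
  by case: (eqVneq (l i) 0) => [->|/mP[_ [-> _]]]; rewrite ?mul0r ?mulr1.
transitivity (\sum_i \sum_j (l i * m i j) *: Y`_j); last first.
  by rewrite exchange_big; apply: eq_bigr => j _; rewrite scaler_suml.
apply: eq_bigr => i _; case: (eqVneq (l i) 0) => [->|/mP[_ [_ ->]]].
  by rewrite scale0r big1 // => j _; rewrite mul0r scale0r.
by rewrite scaler_sumr; apply: eq_bigr => j _; rewrite scalerA.
Qed.

Lemma convR_sub k (X Y : seq 'cV[R]_k) x :
  (forall y, y \in X -> convR Y y) -> convR X x -> convR Y x.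
Proof.
move=> XY [l [l0 [l1 ->]]]; apply: convR_comb => // i _.
by apply: XY; rewrite mem_nth.
Qed.

Variable n : nat.
Implicit Types (V S : seq (pt n)) (w : pt n -> rat) (E : {fset pt n}).

Lemma lattice_pt_mem V a : a \in V -> lattice_pt R V a.
Proof. by move=> aV; apply/convR_mem/map_f. Qed.

(** This makes the list of all lattice points of P a support with Newton polytope P. *)
Lemma convZ_lattice_pts V S :
  (forall a, a \in S <-> lattice_pt R V a) -> forall x : 'cV[R]_n, convZ S x <-> convZ V x.
Proof.
move=> SV x; split; apply: convR_sub => _ /mapP[a aS ->]; first exact/SV.
by apply/convR_mem/map_f/SV/lattice_pt_mem.
Qed.

Lemma lattice_pt_bound V a k : lattice_pt R V a ->
  `|a k 0| <= (\max_(b <- V) absz (b k ord0))%N%:Z.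
Proof.
case=> l [l0 [l1 e]]; set D := (\max_(b <- V) _)%N.
have : `|(a k 0)%:~R : R| <= D%:~R.
  have -> : (a k 0)%:~R = \sum_i l i * (map (@realv R n) V)`_i k 0.
    have := congr1 (fun x : 'cV[R]_n => x k 0) e; rewrite mxE summxE => ->.
    by apply: eq_bigr => i _; rewrite mxE.
  rewrite (le_trans (ler_norm_sum _ _ _)) //.
  rewrite [leRHS](_ : _ = (\sum_i l i) * D%:~R); last by rewrite l1 mul1r.
  rewrite mulr_suml.
  apply: ler_sum => i _; rewrite normrM ger0_norm // ler_wpM2l //.
  have iV : (i < size V)%N by rewrite -(size_map (@realv R n)).
  rewrite (nth_map 0) // mxE -intr_norm ler_int -abszE lez_nat.
  exact: (leq_bigmax_seq (F := fun b : pt n => absz (b k ord0)) _ (mem_nth 0 iV)).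
by rewrite -intr_norm ler_int.
Qed.

Lemma lattice_pts_finite V :
  exists2 S, uniq S & forall a, a \in S <-> lattice_pt R V a.
Proof.
have [D VD] : exists D, forall a k, lattice_pt R V a -> `|a k 0| <= D%:Z.
  exists (\max_k \max_(b <- V) absz (b k ord0))%N => a k aV.
  apply: le_trans (lattice_pt_bound k aV) _; rewrite lez_nat.
  exact: (leq_bigmax (F := fun k : 'I_n => (\max_(b <- V) absz (b k ord0))%N)).
pose L := [seq Genericity.expo f | f : {ffun 'I_n -> 'I_D.*2.+1}].
exists (undup [seq a <- L | boolp.asbool (lattice_pt R V a)]); first exact: undup_uniq.
move=> a; rewrite mem_undup mem_filter; split=> [/andP[/boolp.asboolP//]|aV].
apply/andP; split; first exact/boolp.asboolP.
have [f ->] := Genericity.expo_surj (fun k => VD a k aV).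
by apply/mapP; exists f => //; rewrite mem_enum.
Qed.

Lemma liftpt_height w (c : 'cV[R]_n) (d : R) a :
  dsubmx (liftpt R w a) 0 0 - (c^T *m usubmx (liftpt R w a)) 0 0 - d
    = ratr (w a) - affv c d a.
Proof. by rewrite /liftpt col_mxKd col_mxKu mxE eqxx mulr1n /affv opprD addrA. Qed.

(* A point that is a vertex of some lower facet E' cannot be a convex combination
   of the other points of E, because the height above the hyperplane of E'
   vanishes at the point and is nonnegative elsewhere. *)
Lemma lower_facet_vertex V w E a : regular_triangulation R V w ->
  lower_facet R V w E -> a \in E -> vertex_of R w E a.
Proof.
move=> [htri _] lE aE; split=> // -[l [l0 [l1 e]]].
have [c [d [cd [EP _]]]] := lE; have [aV _] := (EP a).1 aE.
have [E' [[c' [d' [cd' [E'P _]]]] [aE' nvE']]] := htri a aV.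
apply: nvE'; rewrite e; set X := map _ _ in l l0 l1 e *.
pose h (y : 'cV[R]_(n + 1)) := dsubmx y 0 0 - (c'^T *m usubmx y) 0 0.
have hD y y' : h (y + y') = h y + h y'.
  by rewrite /h !linearD /= !mxE; ring.
have hZ r y : h (r *: y) = r * h y.
  by rewrite /h !linearZ /= !mxE; ring.
have h0 : h 0 = 0 by rewrite -[0](scale0r 0) hZ mul0r.
have hsum : h (liftpt R w a) = \sum_i l i * h X`_i.
  by rewrite e (big_morph h hD h0); apply: eq_bigr => i _; rewrite hZ.
have hE b : h (liftpt R w b) - d' = ratr (w b) - affv c' d' b by exact: liftpt_height.
have XiP (i : 'I_(size X)) : exists2 b, b \in rem a (enum_fset E) & X`_i = liftpt R w b.
  by have /mapP[b bE ->] : X`_i \in X by [rewrite mem_nth]; exists b.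
have ge0 i : 0 <= l i * (h X`_i - d').
  have [b /mem_rem bE ->] := XiP i; rewrite mulr_ge0 // hE subr_ge0 cd' //.
  by have [] := (EP b).1 bE.
have sum0 : \sum_i l i * (h X`_i - d') = 0.
  transitivity (h (liftpt R w a) - d').
    under eq_bigr do rewrite mulrBr; rewrite sumrB -hsum -mulr_suml l1 mul1r //.
  by rewrite hE; have [_ ->] := (E'P a).1 aE'; rewrite subrr.
(* The nonnegative terms of [sum0] all vanish, so a point of nonzero weight lies on the hyperplane
   of [E'], hence in [E']. *)
apply: convR_comb => // i li.
have [b bE eb] := XiP i; rewrite eb; apply/convR_mem/map_f.
have /eqP := sum0; rewrite psumr_eq0 // => /allP/(_ i (mem_index_enum _)) /=.
rewrite mulf_eq0 (negPf li) /= eb hE subr_eq0 => /eqP wb.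
have [bV _] := (EP b).1 (mem_rem bE).
have bE' : b \in E' by apply/E'P.
have : b != a by move: bE; rewrite mem_rem_uniq ?fset_uniq // => /andP[].
by move=> ba; rewrite mem_rem_uniq ?fset_uniq // inE ba.
Qed.

(** A repeated point would produce a zero column or two equal columns. *)
Lemma diffmx_inj (v : 'I_n.+1 -> pt n) : \det (Defs.diffmx v) != 0 -> injective v.
Proof.
move=> dv.
have v0 j : v (lift ord0 j) != v ord0.
  apply: contra dv => /eqP e; rewrite (expand_det_col _ j) big1 // => i _.
  by rewrite mxE e subrr mul0r.
move=> i i'; case: (unliftP ord0 i) => [j|] ->; case: (unliftP ord0 i') => [j'|] -> //.
- move=> e; congr (lift _ _); apply/eqP; apply: contraNT dv => jj'.
  rewrite -det_tr; apply/eqP/(determinant_alternate jj') => k.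
  by rewrite !mxE e.
- by move=> e; have := v0 j; rewrite e eqxx.
- by move=> e; have := v0 j'; rewrite e eqxx.
Qed.

End Convexity.

Section Vandermonde.
Variables (F : fieldType) (n : nat) (mu : 'I_n.+1 -> F).
Hypothesis mu_inj : injective mu.

(** With [moment_col] as column 0, this is the coefficient matrix (mu_l^i) of the system restricted
    to the n+1 vertices of a cell. *)
Definition moment_mx : 'M[F]_n := Vandermonde n (\row_j mu (lift ord0 j)).
Definition moment_col : 'cV[F]_n := \col_i mu ord0 ^+ i.

Lemma moment_unit : moment_mx \in unitmx.
Proof.
rewrite unitmxE det_Vandermonde unitfE; apply/prodf_neq0 => i _.
apply/prodf_neq0 => j ij; rewrite !mxE subr_eq0 (inj_eq mu_inj) (inj_eq lift_inj).
by apply: contraTneq ij => ->; rewrite ltnn.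
Qed.

(* Were the entry j zero, pairing with the coefficients of the polynomial
   vanishing at all nodes but mu_0 and mu_j would give a contradiction. *)
Lemma moment_solution_neq0 j : (invmx moment_mx *m moment_col) j 0 != 0.
Proof.
set x := _ *m _; apply/negP => /eqP xj.
have Bx : moment_mx *m x = moment_col by rewrite /x mulKVmx // moment_unit.
pose p := \prod_(l <- enum (predC1 j)) ('X - (mu (lift ord0 l))%:P).
have sp : (size p <= n)%N.
  rewrite /p -(big_map (fun l => mu (lift ord0 l)) predT (fun a => 'X - a%:P)).
  rewrite size_prod_XsubC size_map -cardE cardC1 card_ord.
  by rewrite prednK // (leq_ltn_trans _ (ltn_ord j)).
have e1 : p.[mu ord0] = \sum_l x l 0 * p.[mu (lift ord0 l)].
  rewrite (horner_coef_wide _ sp).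
  transitivity (\sum_(i < n) \sum_l p`_i * (mu (lift ord0 l) ^+ i * x l 0)).
    apply: eq_bigr => i _; rewrite -mulr_sumr; congr (_ * _).
    have := congr1 (fun y : 'cV[F]_n => y i 0) Bx; rewrite [RHS]mxE => <-.
    by rewrite mxE; apply: eq_bigr => l _; rewrite !mxE.
  rewrite exchange_big; apply: eq_bigr => l _.
  rewrite (horner_coef_wide _ sp) mulr_sumr; apply: eq_bigr => i _; ring.
have : p.[mu ord0] != 0.
  rewrite /p horner_prod prodf_seq_neq0; apply/allP => l _ /=.
  by rewrite hornerXsubC subr_eq0 (inj_eq mu_inj).
rewrite e1 big1 ?eqxx // => l _; have [->|lj] := eqVneq l j; first by rewrite xj mul0r.
rewrite /p horner_prod (big_rem l) /=; last by rewrite mem_enum.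
by rewrite hornerXsubC subrr mul0r mulr0.
Qed.

End Vandermonde.

From mathcomp Require Import boolp classical_sets functions interval_inference topology normedtype sequences exp.
Import numFieldNormedType.Exports.

(** * Real solutions near a simplex *)

(** Provides column vectors as a complete space for the Banach fixed point theorem. *)
HB.instance Definition _ (R : realType) n := Complete.on 'cV[R]_n.

Section FixedPoint.
Variable R : realType.

Lemma ln_lipschitz (m x y : R) : 0 < m -> m <= x -> m <= y ->
  `|ln x - ln y| <= `|x - y| / m.
Proof.
move=> m0; wlog yx : x y / y <= x => [hw mx my|mx my].
  have [yx|/ltW xy] := leP y x; first exact: hw.
  by rewrite (distrC (ln x)) (distrC x); exact: hw.
have y0 : 0 < y by apply: lt_le_trans my.
have x0 : 0 < x by apply: lt_le_trans mx.
rewrite !ger0_norm ?subr_ge0 ?ler_ln ?posrE //.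
rewrite -ln_div ?posrE // (_ : x / y = 1 + (x - y) / y); last by field; rewrite gt_eqF.
apply: (@le_trans _ _ ((x - y) / y)).
  apply: le_ln1Dx; apply: (@lt_le_trans _ _ 0); first by rewrite ltrN10.
  by rewrite divr_ge0 ?subr_ge0 // ltW.
by rewrite ler_wpM2l ?subr_ge0 // lef_pV2 ?posrE.
Qed.

Lemma expR_lipschitz (M x y : R) : x <= M -> y <= M ->
  `|expR x - expR y| <= expR M * `|x - y|.
Proof.
wlog yx : x y / y <= x => [hw xM yM|xM yM].
  have [yx|/ltW xy] := leP y x; first exact: hw.
  by rewrite (distrC (expR x)) (distrC x); exact: hw.
rewrite !ger0_norm ?subr_ge0 ?ler_expR //.
apply: (@le_trans _ _ (expR x * (x - y))); last first.
  by rewrite ler_wpM2r ?subr_ge0 // ler_expR.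
have -> : expR y = expR x * expR (y - x) by rewrite -expRD addrC subrK.
have := expR_ge1Dx (y - x); have := expR_gt0 x; nra.
Qed.

Lemma cV_normP n (x : 'cV[R]_n) (c : R) : 0 <= c ->
  (`|x| <= c) <-> (forall k, `|x k 0| <= c).
Proof.
move=> c0; rewrite /Num.norm /= mx_normrE; split=> [h k|h].
  by apply: le_trans h; apply: (le_bigmax _ (fun i : 'I_n * 'I_1 => `|x i.1 i.2|) (k, 0)).
by apply: bigmax_le => // -[k j] _; rewrite ord1; exact: h.
Qed.

Lemma coord_le_norm n (x : 'cV[R]_n) k : `|x k 0| <= `|x|.
Proof. exact: (cV_normP x (normr_ge0 _)).1. Qed.

(** After taking logarithms this is a fixed point problem, solved by contraction on the ball of
    radius [C]. Both [C] and [d] are chosen before the perturbation [k]. *)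
Lemma exp_system_solvable (T : eqType) n (S : seq T) (q : T -> 'I_n -> R) (b : 'I_n -> R) :
  (forall j, 0 < b j) ->
  exists C d : R, 0 < d /\ forall k : 'I_n -> T -> R,
    (forall j a, a \in S -> `|k j a| <= d) ->
    exists x : 'cV[R]_n, (forall j, `|x j 0| <= C) /\
      forall j, expR (x j 0) =
        b j + \sum_(a <- S) k j a * expR (\sum_i q a i * x i 0).
Proof.
move=> b0.
pose C := 1 + \sum_j `|ln (b j)|.
have C0 : 0 <= C by rewrite addr_ge0 // sumr_ge0.
have lnC j : `|ln (b j)| + 1 <= C.
  by rewrite addrC lerD2l (bigD1 j) //= lerDl sumr_ge0.
(* An explicit positive lower bound for all [b j], meaningful also for n = 0. *)
pose m := (1 + \sum_j (b j)^-1)^-1.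
have m_gt0 : 0 < m by rewrite invr_gt0 ltr_pwDl // sumr_ge0 // => j _; rewrite invr_ge0 ltW.
have mb j : m <= b j.
  rewrite -[b j]invrK lef_pV2 ?posrE ?invr_gt0 // ?(ltr_pwDl, sumr_ge0) //; last first.
    by move=> i _; rewrite invr_ge0 ltW.
  rewrite (bigD1 j) //= addrCA lerDl addr_ge0 // sumr_ge0 // => i _.
  by rewrite invr_ge0 ltW.
pose Q a := \sum_i `|q a i|.
have Q0 a : 0 <= Q a by rewrite sumr_ge0.
pose E := \sum_(a <- S) expR (Q a * C).
pose L := \sum_(a <- S) expR (Q a * C) * Q a.
have E0 : 0 <= E by rewrite sumr_ge0 // => a _; rewrite expR_ge0.
have L0 : 0 <= L by rewrite sumr_ge0 // => a _; rewrite mulr_ge0 // expR_ge0.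
have EL0 : 0 < 1 + E + L by rewrite -addrA ltr_pwDl // addr_ge0.
(* On the ball, [E] and [L] bound the sum of exponentials and its Lipschitz constant, so the
   perturbation has both bounded by m/4. The argument of ln then stays above m/2, where ln is
   (2/m)-Lipschitz: the map contracts by 1/2. *)
pose d := (m / 4) / (1 + E + L).
have d0 : 0 < d by rewrite !divr_gt0.
have dEL : d * (1 + E + L) = m / 4 by rewrite mulfVK // gt_eqF.
exists C, d; split=> // k kd.
pose lin a (x : 'cV[R]_n) := \sum_i q a i * x i 0.
have linB a x y : `|lin a x - lin a y| <= Q a * `|x - y|.
  rewrite /lin -sumrB mulr_suml (le_trans (ler_norm_sum _ _ _)) // ler_sum // => i _.
  rewrite -mulrBr normrM ler_wpM2l //.
  by have := coord_le_norm (x - y) i; rewrite !mxE.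
have linC a x : `|x| <= C -> lin a x <= Q a * C.
  move=> xC; rewrite (le_trans (ler_norm _)) //.
  have := linB a x 0; rewrite subr0 /lin [X in _ - X]big1 ?subr0; last first.
    by move=> i _; rewrite mxE mulr0.
  by move=> /le_trans; apply; rewrite ler_wpM2l.
pose pert j x := \sum_(a <- S) k j a * expR (lin a x).
have pertC j x : `|x| <= C -> `|pert j x| <= m / 4.
  move=> xC; rewrite -dEL (le_trans (ler_norm_sum _ _ _)) //.
  apply: (@le_trans _ _ (d * E)); last by rewrite ler_wpM2l ?ltW //; lra.
  rewrite mulr_sumr big_seq [leRHS]big_seq ler_sum // => a aS.
  rewrite normrM ler_pM // ?kd // ger0_norm ?expR_ge0 // ler_expR.
  exact: linC.
have pertB j x y : `|x| <= C -> `|y| <= C ->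
    `|pert j x - pert j y| <= m / 4 * `|x - y|.
  move=> xC yC; rewrite -dEL /pert -sumrB (le_trans (ler_norm_sum _ _ _)) //.
  apply: (@le_trans _ _ (d * L * `|x - y|)); last first.
    by rewrite ler_wpM2r // ler_wpM2l ?ltW //; lra.
  rewrite -mulrA mulr_suml mulr_sumr big_seq [leRHS]big_seq ler_sum // => a aS.
  rewrite -mulrBr normrM ler_pM // ?kd //.
  rewrite (le_trans (expR_lipschitz (linC a x xC) (linC a y yC))) //.
  by rewrite -mulrA ler_wpM2l ?expR_ge0.
have m2 j x : `|x| <= C -> m / 2 <= b j + pert j x.
  by move=> /(pertC j); rewrite ler_norml => /andP[]; have := mb j; lra.
pose f (x : 'cV[R]_n) := \col_j ln (b j + pert j x).
pose U := [set x : 'cV[R]_n | `|x| <= C]%classic.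
have fU : {homo f : x / U x >-> U x}.
  move=> x xC; apply/cV_normP => // j; rewrite mxE.
  rewrite -[ln _](subrK (ln (b j))) (le_trans (ler_normD _ _)) //.
  rewrite (le_trans _ (lnC j)) // addrC lerD2l.
  have m20 : 0 < m / 2 by rewrite divr_gt0.
  rewrite (le_trans (ln_lipschitz m20 (m2 j x xC) _)) //; first by have := mb j; lra.
  rewrite addrC addKr ler_pdivrMr // mul1r (le_trans (pertC j x xC)) //; lra.
have ctr : is_contraction (mkfun fU).
  exists (2^-1)%:nng; split=> /=; first by lra.
  move=> [x y] [/= xC yC]; apply/cV_normP; first by rewrite mulr_ge0.
  move=> j; rewrite !mxE.
  have m20 : 0 < m / 2 by rewrite divr_gt0.
  rewrite (le_trans (ln_lipschitz m20 (m2 j x xC) (m2 j y yC))) //.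
  rewrite ler_pdivrMr // opprD addrACA subrr add0r.
  by rewrite (le_trans (pertB j x y xC yC)) //; lra.
have Ucl : topology_structure.closed U.
  by apply: (@preimage_closed _ _ (fun x : 'cV[R]_n => `|x|) [set r : R | r <= C]%classic); [move=> x _; exact: norm_continuous|exact: closed_le].
have U0 : (U !=set0)%classic by exists 0; rewrite /U /= normr0.
have [x xU xf] := banach_fixed_point ctr Ucl U0.
exists x; split; first exact/(cV_normP x C0).
move=> j; rewrite {1}xf /= mxE lnK // posrE.
by rewrite (lt_le_trans _ (m2 j x xU)) // divr_gt0.
Qed.

End FixedPoint.

(** * Perturbed systems supported on an odd simplex *)

Section SimplexSystem.
Variable R : realType.

Lemma expRXz (x : R) (m : int) : expR x ^ m = expR (m%:~R * x).
Proof.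
case: m => m; first by rewrite -exprnP expRM_natl.
by rewrite NegzE -exprnN rmorphN /= mulNr expRN -pmulrn expRM_natl.
Qed.

Lemma mon_expR n (t : 'cV[R]_n) (a : pt n) :
  mon (\col_k expR (t k 0)) a = expR (((realv R a)^T *m t) 0 0).
Proof.
rewrite mxE expR_sum; apply: eq_bigr => k _.
by rewrite !mxE expRXz.
Qed.

Lemma exprz_sum (F : fieldType) (x : F) (I : Type) (r : seq I) (f : I -> int) :
  x != 0 -> x ^ (\sum_(i <- r) f i) = \prod_(i <- r) x ^ f i.
Proof.
move=> x0; elim: r => [|i r IH]; first by rewrite !big_nil expr0z.
by rewrite !big_cons expfzDr // IH.
Qed.

Lemma signr_expz_odd (F : fieldType) (e : bool) (m : int) : odd `|m|%N ->
  ((-1) ^+ e : F) ^ m = (-1) ^+ e.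
Proof.
move=> om; case: e; rewrite ?expr0 ?exp1rz // expr1.
have N m' : odd m' -> (-1 : F) ^+ m' = -1 by rewrite -signr_odd => ->; rewrite expr1.
case: m om => m /= om; first by rewrite -exprnP N.
by rewrite NegzE -exprnN N // invrN1.
Qed.

(* The adjugate inverts an odd matrix modulo 2. *)
Lemma odd_signs n (M : 'M[int]_n) (e : 'I_n -> bool) : odd `|\det M|%N ->
  exists s : 'cV[R]_n, (forall k, `|s k 0| = 1) /\
    forall j, mon s (col j M) = (-1) ^+ e j.
Proof.
move=> oM; pose u : 'rV[int]_n := (\row_j (e j : nat)%:Z) *m \adj M.
have N1 : (-1 : R) != 0 by rewrite oppr_eq0 oner_neq0.
exists (\col_k (-1) ^ u 0 k); split=> [k|j].
  rewrite mxE; case: (u 0 k) => m; rewrite ?NegzE -?exprnN ?normfV -?exprnP.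
    by rewrite normrX normrN1 expr1n.
  by rewrite normrX normrN1 expr1n invr1.
transitivity ((-1 : R) ^ (u *m M) 0 j).
  rewrite mxE exprz_sum //; apply: eq_bigr => k _.
  by rewrite !mxE exprzAC // -exprz_exp exprzAC.
(* [u *m M] is [\det M] times the row of [e], and an odd exponent leaves a sign unchanged. *)
by rewrite -mulmxA mul_adj_mx mul_mx_scalar !mxE mulrC -exprz_exp -exprnP signr_expz_odd.
Qed.

Lemma normr_mon n (s : 'cV[R]_n) (a : pt n) : (forall k, `|s k 0| = 1) -> `|mon s a| = 1.
Proof.
move=> s1; rewrite /mon normr_prod big1 // => k _.
case: (a k 0) => m; rewrite ?NegzE -?exprnN ?normfV -?exprnP normrX s1 expr1n //.
by rewrite invr1.
Qed.

(* After multiplication by B^-1 and division by x^(v_0), the unperturbed system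
   prescribes the monomials x^(v_j - v_0), hence the signs of x, by odd_signs, and
   log |x|, which then solves a perturbed exponential system. *)
Lemma simplex_system_perturb n (S : seq (pt n)) (v : 'I_n.+1 -> pt n) (B : 'M[R]_n)
    (b0 : 'cV[R]_n) : odd `|\det (Defs.diffmx v)|%N -> B \in unitmx ->
    (forall j, (invmx B *m b0) j 0 != 0) ->
  exists K : R, 0 < K /\ forall k : 'I_n -> pt n -> R,
    (forall i a, a \in S -> `|k i a| <= K^-1) ->
    exists z : 'cV[R]_n, torus z /\
      (forall a, a \in S -> K^-1 <= `|mon z a| <= K) /\
      forall i, b0 i 0 * mon z (v ord0) + \sum_j B i j * mon z (v (lift ord0 j))
         + \sum_(a <- S) k i a * mon z a = 0.
Proof.
move=> oM uB bn0.
(* The values that the unperturbed system prescribes for the monomials z^(v_j - v_0). *)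
pose be := - (invmx B *m b0).
have be0 j : be j 0 != 0 by rewrite mxE oppr_eq0.
have [s [s1 sM]] := odd_signs (fun j => be j 0 < 0) oM.
pose M : 'M[R]_n := (map_mx intr (Defs.diffmx v))^T.
have uM : M \in unitmx.
  rewrite unitmxE det_tr det_map_mx unitfE intr_eq0.
  by apply: contraTneq oM => ->.
(* The coordinates of [a] in the basis v_j - v_0: the unknowns x_j are the logarithms of |z^(v_j -
   v_0)|, and log |z^a| is linear in them. *)
pose q a i := ((realv R a)^T *m invmx M) 0 i.
have colE j : col j (Defs.diffmx v) = v (lift ord0 j) - v ord0.
  by apply/matrixP => i l; rewrite ord1 !mxE.
have qM (x : 'cV[R]_n) j :
    ((realv R (v (lift ord0 j) - v ord0))^T *m (invmx M *m x)) 0 0 = x j 0.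
  have -> : (realv R (v (lift ord0 j) - v ord0))^T = row j M.
    by rewrite -colE; apply/matrixP => i l; rewrite !mxE.
  by rewrite -row_mul mulKVmx // mxE.
have qE a (x : 'cV[R]_n) : \sum_i q a i * x i 0 = ((realv R a)^T *m (invmx M *m x)) 0 0.
  by rewrite mulmxA mxE.
have abs_gt0 j : 0 < `|be j 0| by rewrite normr_gt0.
have [C [d [d0 hC]]] := exp_system_solvable S (fun a => q (a - v ord0)) abs_gt0.
pose N := \sum_j \sum_i `|invmx B j i|.
have N0 : 0 <= N by rewrite sumr_ge0 // => j _; rewrite sumr_ge0.
pose D := \sum_(a <- S) \sum_i `|q a i| * `|C|.
(* The first summand bounds the monomials on both sides; the second keeps coefficients of size 1/K
   below [d] after multiplication by the inverse of [B]. *)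
pose K := expR D + (N + 1) / d.
have Nd0 : 0 < (N + 1) / d by rewrite divr_gt0 // ltr_wpDl.
have eD : expR D <= K by rewrite lerDl ltW.
have K0 : 0 < K by rewrite ltr_pwDl // ?expR_gt0 // ltW.
have NK : N * K^-1 <= d.
  rewrite ler_pdivrMr // mulrDr [d * ((N + 1) / d)]mulrC mulfVK ?gt_eqF //.
  by have := mulr_gt0 d0 (expR_gt0 D); lra.
exists K; split=> // k kK.
pose k' j a := \sum_i invmx B j i * k i a.
have k'd j a : a \in S -> `|k' j a| <= d.
  move=> aS; apply: le_trans NK; rewrite (le_trans (ler_norm_sum _ _ _)) //.
  apply: (@le_trans _ _ ((\sum_i `|invmx B j i|) * K^-1)).
    by rewrite mulr_suml ler_sum // => i _; rewrite normrM ler_wpM2l // kK.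
  rewrite ler_wpM2r ?invr_ge0 ?(ltW K0) // /N [leRHS](bigD1 j) //= lerDl.
  by rewrite sumr_ge0 // => i _; rewrite sumr_ge0.
pose sg j : R := (-1) ^+ (be j 0 < 0)%R.
have sg2 j : sg j * sg j = 1 by rewrite /sg -signr_addb addbb.
(* The signs of be_j and of the monomials are absorbed into the coefficients, leaving a system for
   the positive numbers exp(x_j). *)
pose k2 j a := - sg j * k' j a * mon s (a - v ord0).
have k2d j a : a \in S -> `|k2 j a| <= d.
  move=> aS; rewrite !normrM normrN normrX normrN1 expr1n mul1r.
  by rewrite normr_mon // mulr1 k'd.
have [x [xC xE]] := hC k2 k2d.
pose t := invmx M *m x.
pose z := \col_l (s l 0 * (\col_k expR (t k 0)) l 0).
have zE a : mon z a = mon s a * expR (\sum_i q a i * x i 0).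
  by rewrite /z monZ mon_expR qE.
have tz : torus z.
  move=> l; rewrite !mxE mulf_neq0 //; last by rewrite gt_eqF ?expR_gt0.
  by rewrite -normr_eq0 s1 oner_neq0.
exists z; split=> //; split.
  move=> a aS; rewrite zE normrM normr_mon // mul1r ger0_norm ?expR_ge0 //.
  have : `|\sum_i q a i * x i 0| <= D.
    rewrite (le_trans (ler_norm_sum _ _ _)) // /D (big_rem a) //= ler_wpDr //.
      by rewrite sumr_ge0 // => i _; rewrite sumr_ge0 // => ? _; rewrite mulr_ge0.
    by apply: ler_sum => i _; rewrite normrM ler_wpM2l // (le_trans (xC i)) // ler_norm.
  rewrite ler_norml => /andP[l1 l2].
  rewrite (le_trans _ eD) ?ler_expR // andbT.
  apply: (@le_trans _ _ (expR (- D))); last by rewrite ler_expR.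
  by rewrite expRN lef_pV2 // ?posrE ?expR_gt0.
have zv j : mon z (v (lift ord0 j) - v ord0) + \sum_(a <- S) k' j a * mon z (a - v ord0) = be j 0.
  have -> : mon z (v (lift ord0 j) - v ord0) = sg j * expR (x j 0).
    by rewrite zE qE qM -colE sM.
  rewrite xE mulrDr mulr_sumr -addrA -big_split big1 ?addr0 /= => [|a _].
    by rewrite /sg -realEsign ?num_real.
  rewrite /k2 zE; transitivity ((1 - sg j * sg j) *
    (k' j a * mon s (a - v ord0) * expR (\sum_i q (a - v ord0) i * x i 0))); first by ring.
  by rewrite sg2 subrr mul0r.
move=> i; have z0 : mon z (v ord0) != 0 by exact: mon_neq0.
have monE a : mon z a = mon z (a - v ord0) * mon z (v ord0).
  by rewrite -monD // subrK.
have Bk a : \sum_j B i j * k' j a = k i a.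
  transitivity ((B *m invmx B *m \col_l k l a) i 0); last by rewrite mulmxV // mul1mx mxE.
  rewrite -mulmxA mxE; apply: eq_bigr => j _; congr (_ * _); rewrite mxE.
  by apply: eq_bigr => l _; rewrite mxE.
have Bb : \sum_j B i j * be j 0 = - b0 i 0.
  transitivity ((B *m be) i 0); first by rewrite mxE.
  by rewrite mulmxN mulKVmx // mxE.
have -> : \sum_j B i j * mon z (v (lift ord0 j)) =
    (\sum_j B i j * mon z (v (lift ord0 j) - v ord0)) * mon z (v ord0).
  by rewrite mulr_suml; apply: eq_bigr => j _; rewrite [in LHS]monE mulrA.
have -> : \sum_(a <- S) k i a * mon z a =
    (\sum_(a <- S) k i a * mon z (a - v ord0)) * mon z (v ord0).
  by rewrite mulr_suml; apply: eq_bigr => a _; rewrite [in LHS]monE mulrA.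
rewrite -[b0 i 0]opprK -Bb -!mulrDl; apply/eqP; rewrite mulf_eq0 (negPf z0) orbF.
rewrite -addrA addrC subr_eq0; apply/eqP.
transitivity (\sum_j B i j * (mon z (v (lift ord0 j) - v ord0) + \sum_(a <- S) k' j a * mon z (a - v ord0))).
  under [RHS]eq_bigr do rewrite mulrDr mulr_sumr.
  rewrite big_split; congr (_ + _); rewrite exchange_big; apply: eq_bigr => a _.
  by rewrite -Bk mulr_suml; apply: eq_bigr => j _; rewrite mulrA.
by apply: eq_bigr => j _; rewrite zv.
Qed.

End SimplexSystem.

(** * Cells and the deformed system *)

Section Cells.
Variable R : realType.

Lemma eventually_all (T : eqType) (s : seq T) (P : T -> R -> Prop) :
  (forall x, x \in s -> exists M, forall m, M <= m -> P x m) ->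
  exists M, forall m, M <= m -> forall x, x \in s -> P x m.
Proof.
elim: s => [|x s IH] h; first by exists 0.
have [M1 h1] := h x (mem_head _ _).
have [|M2 h2] := IH; first by move=> y ys; apply: h; rewrite in_cons ys orbT.
exists (Num.max M1 M2) => m; rewrite ge_max => /andP[m1 m2] y.
by rewrite in_cons => /orP[/eqP ->|ys]; [exact: h1|exact: h2].
Qed.

Lemma expR_decay (M r t0 : R) : 0 < r -> 0 < t0 ->
  exists T, forall t, T <= t -> M * expR (- t * r) <= t0.
Proof.
(* The threshold comes from 1 + t r <= exp(t r). *)
move=> r0 t00; exists (M / (t0 * r)) => t.
rewrite ler_pdivrMr ?mulr_gt0 // mulNr expRN ler_pdivrMr ?expR_gt0 // => h.
have := expR_ge1Dx (t * r); nra.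
Qed.

Variable n : nat.
Implicit Types (S : seq (pt n)) (wr mu : pt n -> R) (E : {fset pt n}) (v : 'I_n.+1 -> pt n).

(** Compared with [odd_cell], here [E] consists of exactly the n+1 vertices, and the supporting
    function is tested on the finite list [S]. *)
Definition is_cell S wr E (c : 'cV[R]_n) (d : R) v :=
  [/\ forall a, a \in S -> affv c d a <= wr a,
      forall a, a \in E <-> a \in S /\ affv c d a = wr a,
      forall a, a \in E <-> exists i, a = v i,
      injective v & odd `|\det (Defs.diffmx v)|%N].

Lemma odd_cell_is_cell (V : seq (pt n)) S w E :
  (forall a, a \in S <-> lattice_pt R V a) -> regular_triangulation R V w ->
  odd_cell R V w E -> exists c d v, is_cell S (fun a => ratr (w a)) E c d v.
Proof.
move=> SV htri [lE [v [vE ov]]]; have [c [d [cd [EP _]]]] := lE.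
exists c, d, v; split=> //.
- by move=> a /SV; exact: cd.
- move=> a; split=> [/EP[/SV //]|[/SV aV aw]]; exact/EP.
- move=> a; split=> [aE|/vE[]//].
  exact/vE/(lower_facet_vertex htri lE aE).
- by apply: diffmx_inj; apply: contraTneq ov => ->.
Qed.

Section OneCell.
Variables (S : seq (pt n)) (wr mu : pt n -> R) (E : {fset pt n}) (c : 'cV[R]_n) (d : R).
Variables (v : 'I_n.+1 -> pt n) (a0 : pt n).
Hypothesis uS : uniq S.
Hypothesis cellE : is_cell S wr E c d v.

(** The factor exp(-t w) is Viro's deformation, the powers of mu (i starts at 0) put the vertices of
    every cell in general position, and [y] is the generic correction at one exponent. *)
Definition coef (t : R) (y : 'I_n -> R) (i : 'I_n) (a : pt n) : R :=
  mu a ^+ i * expR (- t * wr a) + (if a == a0 then y i else 0).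

(* What is left of the system outside the face E after the substitution
   x_k = exp (t c_k) z_k. *)
Definition residue (t : R) (y : 'I_n -> R) (i : 'I_n) (a : pt n) : R :=
  (if a \in E then 0 else mu a ^+ i * expR (- t * (wr a - affv c d a)))
  + (if a == a0 then y i * expR (t * affv c d a) else 0).

Lemma big_cell (f : pt n -> R) :
  \sum_(a <- S) (if a \in E then f a else 0) = \sum_l f (v l).
Proof.
have [_ EP Ev vi _] := cellE.
rewrite -big_mkcond -big_filter -[RHS](big_map v predT f) /=.
apply: perm_big; apply: uniq_perm; rewrite ?filter_uniq //.
  by rewrite map_inj_uniq // index_enum_uniq.
move=> a; rewrite mem_filter; apply/andP/mapP.
  by case=> /Ev[i ->] _; exists i; rewrite ?mem_index_enum.
case=> i _ ->; have vE : v i \in E by apply/Ev; exists i.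
by split=> //; have [] := (EP (v i)).1 vE.
Qed.

Lemma mon_scale (t : R) (z : 'cV[R]_n) a :
  mon (\col_k ((\col_l expR ((t *: c) l 0)) k 0 * z k 0)) a
    = expR (t * (affv c d a - d)) * mon z a.
Proof.
rewrite monZ mon_expR; congr (expR _ * _).
rewrite /affv addrK -scalemxAr mxE; congr (_ * _).
by rewrite !mxE; apply: eq_bigr => k _; rewrite !mxE mulrC.
Qed.

(* The last conclusion recovers E from x as the set of dominant terms, so that
   distinct cells give distinct solutions. *)
Lemma cell_solution (K t : R) (y : 'I_n -> R) : 0 < K -> 0 <= t ->
  (exists z : 'cV[R]_n, torus z /\ (forall a, a \in S -> K^-1 <= `|mon z a| <= K) /\
    forall i : 'I_n, \sum_l mu (v l) ^+ i * mon z (v l)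
      + \sum_(a <- S) residue t y i a * mon z a = 0) ->
  (forall a, a \in S -> a \notin E ->
     K ^+ 4 * expR (- t * (wr a - affv c d a)) < 1) ->
  exists x : 'cV[R]_n, solR S (coef t y) x /\
    forall a, a \in E <-> a \in S /\ forall b, b \in S ->
      expR (- t * wr b) * `|mon x b| <= K ^+ 2 * (expR (- t * wr a) * `|mon x a|).
Proof.
move=> K0 t0 [z [tz [zK zE]]] sep; have [le_w EP Ev vi _] := cellE.
have [x x0 xE] : exists2 x : 'cV[R]_n, (forall k, x k 0 != 0) &
    forall a, mon x a = expR (t * (affv c d a - d)) * mon z a.
  exists (\col_k ((\col_l expR ((t *: c) l 0)) k 0 * z k 0)) => [k|a].
    by rewrite !mxE mulf_neq0 // gt_eqF ?expR_gt0.
  exact: mon_scale.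
have w_x a : expR (- t * wr a) * `|mon x a| =
    expR (- t * d) * (expR (- t * (wr a - affv c d a)) * `|mon z a|).
  rewrite xE normrM ger0_norm ?expR_ge0 // !mulrA -!expRD; congr (expR _ * _); ring.
exists x; split.
  split=> // i.
  transitivity (expR (- t * d) * (\sum_l mu (v l) ^+ i * mon z (v l)
      + \sum_(a <- S) residue t y i a * mon z a)); last by rewrite zE mulr0.
  rewrite -(big_cell (fun a => mu a ^+ i * mon z a)) -big_split mulr_sumr.
  rewrite /evalR !big_seq; apply: eq_bigr => a aS.
  rewrite xE /coef /residue.
  have e1 : expR (- t * wr a) * expR (t * (affv c d a - d)) =
      expR (- t * d) * expR (- t * (wr a - affv c d a)).
    by rewrite -!expRD; congr expR; ring.
  have e2 : expR (t * (affv c d a - d)) = expR (- t * d) * expR (t * affv c d a).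
    by rewrite -!expRD; congr expR; ring.
  transitivity ((mu a ^+ i * (expR (- t * wr a) * expR (t * (affv c d a - d)))
     + (if a == a0 then y i else 0) * expR (t * (affv c d a - d))) * mon z a); first by ring.
  rewrite e1 e2; case: (boolP (a \in E)) => [aE|aE]; last by case: eqP => _ /=; ring.
  have [_ ->] := (EP a).1 aE; rewrite subrr mulr0 expR0.
  by case: eqP => _ /=; ring.
have K1 : K^-1 * K = 1 by rewrite mulVf // gt_eqF.
have Ki : 0 < K^-1 by rewrite invr_gt0.
have d0 := expR_gt0 (- t * d).
have v0E : v ord0 \in E by apply/Ev; exists ord0.
have [v0S v0w] := (EP _).1 v0E.
move=> a; split=> [aE|[aS h]].
  (* Monomials of z lie between 1/K and K, so two of them differ by a factor of at most K^2, and
     terms outside the face only carry an extra factor at most 1. *)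
  have [aS aw] := (EP a).1 aE; split=> // b bS; rewrite (w_x a) (w_x b) aw subrr mulr0 expR0 mul1r.
  rewrite [leRHS]mulrCA ler_pM2l //.
  have /andP[_ zb] := zK b bS; have /andP[za _] := zK a aS.
  apply: (@le_trans _ _ (1 * K)); last first.
    rewrite mul1r [leLHS](_ : _ = K ^+ 2 * K^-1) ?ler_pM2l ?exprn_gt0 //.
    by rewrite expr2 mulfK ?gt_eqF.
  rewrite ler_pM ?expR_ge0 // -expR0 ler_expR.
  by rewrite mulNr oppr_le0 mulr_ge0 // subr_ge0 le_w.
(* For [a] outside [E], comparison with the vertex [v ord0] would give 1/K <= K^2 e K with e the
   exponential decay of [a], that is 1 <= K^4 e, against [sep]. *)
apply: contraT => aE.
have := h _ v0S; rewrite (w_x a) w_x v0w subrr mulr0 expR0 mul1r [leRHS]mulrCA ler_pM2l //.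
have /andP[zv _] := zK _ v0S; have /andP[_ za] := zK a aS.
have := sep a aS aE; set ea := expR _ => sa; have ea0 : 0 < ea by exact: expR_gt0.
move=> hv.
have : K^-1 <= K ^+ 2 * (ea * K).
  apply: le_trans zv (le_trans hv _); rewrite ler_pM2l ?exprn_gt0 // ler_pM2l //.
have -> : K ^+ 2 * (ea * K) = K^-1 * (K ^+ 4 * ea) by field; rewrite gt_eqF.
by rewrite -[leLHS]mulr1 ler_pM2l // leNgt sa.
Qed.

End OneCell.
End Cells.

(** * Uniform constants and admissibility of the deformed system *)

Section Assembly.
Variables (R : realType) (n : nat).
Implicit Types (S : seq (pt n)) (wr mu : pt n -> R) (E : {fset pt n}) (v : 'I_n.+1 -> pt n).

(** Stated for all [K] beyond a threshold, so that finitely many cells can share one constant. *)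
Lemma cell_perturbation S mu v : (forall i, v i \in S) -> injective v ->
  {in S &, injective mu} -> odd `|\det (Defs.diffmx v)|%N ->
  exists K0 : R, forall K, K0 <= K -> 0 < K /\ forall k : 'I_n -> pt n -> R,
    (forall i a, a \in S -> `|k i a| <= K^-1) ->
    exists z : 'cV[R]_n, torus z /\ (forall a, a \in S -> K^-1 <= `|mon z a| <= K) /\
      forall i : 'I_n, \sum_l mu (v l) ^+ i * mon z (v l) + \sum_(a <- S) k i a * mon z a = 0.
Proof.
move=> vS vi muS ov.
have mi : injective (mu \o v) by move=> i j /muS e; apply/vi/e.
have [K0 [K00 h]] := simplex_system_perturb S ov (moment_unit mi) (moment_solution_neq0 mi).
exists K0 => K K0K; have Kp : 0 < K by apply: lt_le_trans K0K.
have iK : K^-1 <= K0^-1 by rewrite lef_pV2 ?posrE.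
split=> // k kK; have [|z [tz [zS ez]]] := h k.
  by move=> i a aS; apply: le_trans (kK i a aS) iK.
exists z; split=> //; split=> [a aS|i].
  have /andP[z1 z2] := zS a aS.
  by rewrite (le_trans iK z1) (le_trans z2 K0K).
rewrite -[RHS](ez i) big_ord_recl; congr (_ + _ + _); first by rewrite mxE.
by apply: eq_bigr => j _; rewrite !mxE.
Qed.

(** Half of the budget 1/K goes to the decaying terms off the face, half to [y]; mu >= 1 lets mu^n
    bound all mu^i. *)
Lemma residue_small S wr mu E c d v a0 (t K : R) (y : 'I_n -> R) : 0 < K ->
  is_cell S wr E c d v -> (forall a, 1 <= mu a) ->
  (forall a, a \in S -> a \notin E ->
     mu a ^+ n * expR (- t * (wr a - affv c d a)) <= K^-1 / 2) ->
  (forall i, `|y i| * expR (t * affv c d a0) <= K^-1 / 2) ->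
  forall i a, a \in S -> `|residue wr mu E c d a0 t y i a| <= K^-1.
Proof.
move=> K0 cE mu1 hS hy i a aS; rewrite /residue.
have K2 : 0 <= K^-1 / 2 by rewrite divr_ge0 // invr_ge0 ltW.
rewrite (le_trans (ler_normD _ _)) // (splitr K^-1) lerD //; last first.
  case: eqP => [->|_]; last by rewrite normr0.
  by rewrite normrM (ger0_norm (expR_ge0 _)).
case: (boolP (a \in E)) => aE; first by rewrite normr0.
have mu0 : 0 <= mu a by apply: le_trans (mu1 a).
rewrite ger0_norm ?mulr_ge0 ?exprn_ge0 ?expR_ge0 //.
apply: le_trans (hS a aS aE); rewrite ler_wpM2r ?expR_ge0 //.
by rewrite ler_weXn2l // ltnW.
Qed.

Lemma evalC_real S (c : 'I_n -> pt n -> R) i (x : 'cV[R]_n) :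
  evalC S c i (map_mx (real_complex R) x) = (evalR S c i x)%:C%C.
Proof.
rewrite /evalC /evalR rmorph_sum; apply: eq_bigr => a _.
by rewrite rmorphM mon_map.
Qed.

Lemma solC_real S (c : 'I_n -> pt n -> R) (x : 'cV[R]_n) :
  solR S c x -> solC S c (map_mx (real_complex R) x).
Proof.
case=> x0 xE; split=> [k|i]; first by rewrite mxE fmorph_eq0.
by rewrite evalC_real xE.
Qed.

Lemma solR_finite S (c : 'I_n -> pt n -> R) (s : seq 'cV[R[i]]_n) :
  (forall z, solC S c z -> z \in s) ->
  exists r : seq 'cV[R]_n, uniq r /\ forall x, x \in r <-> solR S c x.
Proof.
move=> hs; exists (undup [seq x <- map (map_mx (@complex.Re R)) s | `[<solR S c x>]]).
split=> [|x]; first exact: undup_uniq.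
rewrite mem_undup mem_filter; split=> [/andP[/asboolP//]|sx].
apply/andP; split; first exact/asboolP.
apply/mapP; exists (map_mx (real_complex R) x); first exact/hs/solC_real.
by apply/matrixP => i j; rewrite !mxE.
Qed.

Lemma sum_pick (F : pzSemiRingType) S a0 (y : F) (g : pt n -> F) : uniq S -> a0 \in S ->
  \sum_(a <- S) (if a == a0 then y else 0) * g a = y * g a0.
Proof.
move=> uS aS; rewrite (bigD1_seq a0) //= eqxx big1 ?addr0 // => a /negPf ->.
by rewrite mul0r.
Qed.

Lemma coef_split S wr mu a0 (t : R) (y : 'I_n -> R) i (g : pt n -> R[i]) :
  uniq S -> a0 \in S ->
  \sum_(a <- S) (coef wr mu a0 t y i a)%:C%C * g a =
    \sum_(a <- S) (mu a ^+ i * expR (- t * wr a))%:C%C * g a + (y i)%:C%C * g a0.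
Proof.
move=> uS aS; rewrite -(sum_pick (y i)%:C%C g uS aS) -big_split /=; apply: eq_bigr => a _.
by rewrite -mulrDl /coef rmorphD /=; case: ifP.
Qed.

(** Since z^(a - e_j) = z^a / z_j, the Jacobian acts through logarithmic derivatives, the form used
    by [generic_system]. *)
Lemma jacC_dlog S (c : 'I_n -> pt n -> R) (z v : 'cV[R[i]]_n) i : torus z ->
  (jacC S c z *m v) i 0 = \sum_(a <- S) (c i a)%:C%C * (mon z a * Genericity.dlog z v a).
Proof.
move=> tz; rewrite mxE.
transitivity (\sum_j \sum_(a <- S)
    (c i a)%:C%C * (mon z a * ((a j 0)%:~R * (v j 0 / z j 0)))).
  apply: eq_bigr => j _; rewrite mxE mulr_suml; apply: eq_bigr => a _.
  by rewrite monD // monN mon_delta; ring.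
rewrite exchange_big; apply: eq_bigr => a _.
by rewrite -!mulr_sumr.
Qed.

Lemma generic_perturbation S wr mu a0 (t e : R) : uniq S -> a0 \in S -> 0 < e ->
  exists y : 'I_n -> R, (forall i, 0 < y i <= e) /\
    let c := coef wr mu a0 t y in
    (exists s : seq 'cV[R[i]]_n, forall z, solC S c z -> z \in s) /\
    (forall z, solC S c z -> \det (jacC S c z) != 0).
Proof.
move=> uS aS e0.
have [H H0 hH] := Genericity.generic_system S
  (fun i a => (mu a ^+ (i : 'I_n) * expR (- t * wr a))%:C%C : R[i]) a0.
(* Infinitely many candidates in (0, e] for each y_i, so smallness, positivity and genericity are
   achieved together. *)
pose f (m : nat) (i : 'I_n) : R[i] := (e / m.+1%:R)%:C%C.
have finj i : injective (f^~ i).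
  move=> m m' /complexI /(mulfI (lt0r_neq0 e0)) /invr_inj /eqP.
  by rewrite eqr_nat => /eqP[].
have [m Hm] := Genericity.mpoly_nonroot H0 finj.
have [fin simple] := hH _ Hm.
exists (fun i => e / (m i).+1%:R); split=> [i|c].
  by rewrite divr_gt0 //= ler_pdivrMr // ler_peMr ?(ltW e0) // ler1n.
have sol z : solC S c z -> torus z /\ forall i : 'I_n,
    \sum_(a <- S) (mu a ^+ i * expR (- t * wr a))%:C%C * mon z a + f (m i) i * mon z a0 = 0.
  case=> tz ez; split=> // i; rewrite -[RHS](ez i) /evalC /c.
  by rewrite (coef_split wr mu t _ i (fun a => mon z a) uS aS).
split; first by have [s hs] := fin; exists s => z /sol; exact: hs.
move=> z sz; have [tz _] := sz; rewrite -det_tr; apply/det0P => -[v v0 vJ].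
move/eqP: v0; apply; apply: trmx_inj; rewrite trmx0.
apply: (simple z _ (sol z sz)) => i.
have := congr1 (fun u : 'rV_n => u^T i 0) vJ; rewrite trmx_mul trmxK jacC_dlog // !mxE.
by rewrite (coef_split wr mu t _ i (fun a => mon z a * Genericity.dlog z v^T a) uS aS).
Qed.

Lemma odd_cells_finite (V : seq (pt n)) S w : (forall a, a \in S <-> lattice_pt R V a) ->
  exists L : seq {fset pt n}, forall E, E \in L <-> odd_cell R V w E.
Proof.
move=> SV; pose A : {fset pt n} := seq_fset tt S.
exists [seq E <- enum_fset (fpowerset A) | `[<odd_cell R V w E>]] => E.
rewrite mem_filter; split=> [/andP[/asboolP//]|oE].
apply/andP; split; first exact/asboolP.
have [[c [d [_ [EP _]]]] _] := oE.
rewrite fpowersetE; apply/fsubsetP => a /EP[aV _].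
by rewrite seq_fsetE; apply/SV.
Qed.

End Assembly.

(* #odd cells <= rho(P)  <=>  some admissible system has m real torus
   solutions with m >= #odd cells (every duplicate-free list of odd cells
   has length <= m). *)
Theorem mainTheorem2 (R : realType) (n : nat) (V : seq (pt n))
  (hP : full_dim V) (w : pt n -> rat)
  (hw : forall a, lattice_pt R V a -> 0 <= w a)
  (htri : regular_triangulation R V w) :
  exists m : nat, rho_attained R V m /\
    forall L : seq {fset pt n}, uniq L ->
      (forall E, E \in L -> odd_cell R V w E) -> (size L <= m)%N.
Proof.
have [S uS SV] := lattice_pts_finite R V.
have [v0 [v0V _]] := hP; pose a0 := v0 ord0.
have a0S : a0 \in S by exact: (SV a0).2 (lattice_pt_mem R (v0V ord0)).
pose wr a : R := ratr (w a).
(* Positions in [S] give distinct values, all at least 1. *)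
pose mu a : R := (index a S).+1%:R.
have mu1 a : 1 <= mu a by rewrite ler1n.
have muS : {in S &, injective mu}.
  move=> a b aS bS /eqP; rewrite eqr_nat => /eqP[e].
  by rewrite -(nth_index 0 aS) e nth_index.
have [L0 L0P] := odd_cells_finite w SV.
have [g gP] : {g : {fset pt n} -> 'cV[R]_n * R * ('I_n.+1 -> pt n) &
    forall E, E \in L0 -> is_cell S wr E (g E).1.1 (g E).1.2 (g E).2}.
  apply: (@boolp.choice _ _ (fun E t => E \in L0 -> is_cell S wr E t.1.1 t.1.2 t.2)) => E.
  case: (boolP (E \in L0)) => [/L0P oE|_]; last by exists (0, 0, v0).
  have [c [d [v cE]]] := odd_cell_is_cell SV htri oE.
  by exists (c, d, v).
pose c E := (g E).1.1; pose d E := (g E).1.2; pose v E := (g E).2.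
have cellP E : E \in L0 -> is_cell S wr E (c E) (d E) (v E) by exact: gP.
have vS E i : E \in L0 -> v E i \in S.
  case/cellP=> _ EP Ev _ _; have vE : v E i \in E by apply/Ev; exists i.
  by have [] := (EP _).1 vE.
have [K0 hK] := eventually_all (fun E EL => let: And5 _ _ _ vi ov := cellP E EL in
  cell_perturbation (fun i => vS E i EL) vi muS ov).
have {hK} [K Kp hK] : exists2 K, 0 < K & forall E, E \in L0 ->
    forall k : 'I_n -> pt n -> R, (forall i a, a \in S -> `|k i a| <= K^-1) ->
    exists z : 'cV[R]_n, torus z /\ (forall a, a \in S -> K^-1 <= `|mon z a| <= K) /\
      forall i : 'I_n, \sum_l mu (v E l) ^+ i * mon z (v E l)
        + \sum_(a <- S) k i a * mon z a = 0.
  exists (Num.max 1 K0) => [|E EL]; first by rewrite lt_max ltr01.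
  by have [] := hK (Num.max 1 K0) _ E EL; first by rewrite le_max lexx orbT.
have Ki : 0 < K^-1 / 2 by rewrite divr_gt0 ?invr_gt0.
pose ex E a := wr a - affv (c E) (d E) a.
have ex_gt0 E a : E \in L0 -> a \in S -> a \notin E -> 0 < ex E a.
  case/cellP=> le_w EP _ _ _ aS aE; rewrite subr_gt0 lt_neqAle le_w // andbT.
  by apply: contra aE => /eqP aw; apply/EP.
(* The first bound feeds [residue_small], the second is the separation demanded by
   [cell_solution]. *)
have [T hT] : exists T, forall t, T <= t -> forall E, E \in L0 ->
    forall a, a \in S -> a \notin E ->
    mu a ^+ n * expR (- t * ex E a) <= K^-1 / 2 /\ K ^+ 4 * expR (- t * ex E a) < 1.
  apply: eventually_all => E EL; apply: eventually_all => a aS.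
  case: (boolP (a \in E)) => [_|aE]; first by exists 0.
  have [T1 h1] := expR_decay (mu a ^+ n) (ex_gt0 E a EL aS aE) Ki.
  have h0 : 0 < (2^-1 : R) by rewrite invr_gt0.
  have [T2 h2] := expR_decay (K ^+ 4) (ex_gt0 E a EL aS aE) h0.
  exists (Num.max T1 T2) => t; rewrite ge_max => /andP[/h1 t1 /h2 t2] _; split=> //.
  by apply: le_lt_trans t2 _; lra.
pose t := Num.max 0 T.
have t0 : 0 <= t by rewrite le_max lexx.
have Tt : T <= t by rewrite le_max lexx orbT.
have ht := hT t Tt.
(* Only with [K] and [t] fixed is [y] bounded, since the change of coordinates multiplies y_i by
   exp(t (c.a0 + d)). *)
have [M hM] : exists M, forall m, M <= m -> forall E, E \in L0 ->
    0 < m -> m^-1 * expR (t * affv (c E) (d E) a0) <= K^-1 / 2.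
  apply: eventually_all => E _; set x := expR _.
  exists (x / (K^-1 / 2)) => m; rewrite ler_pdivrMr // => h m0.
  by rewrite mulrC ler_pdivrMr // mulrC.
pose e := (Num.max 1 M)^-1.
have e0 : 0 < e by rewrite invr_gt0 lt_max ltr01.
have [y [ye [fin simple]]] := generic_perturbation wr mu t uS a0S e0.
set cf := coef wr mu a0 t y in fin simple.
(* All coefficients are positive, so each support is the whole of [S] and each Newton polytope is
   P. *)
have cf0 i a : cf i a != 0.
  rewrite gt_eqF // /cf /coef ltr_wpDr //.
    by case: ifP => // _; have /andP[/ltW] := ye i.
  by rewrite mulr_gt0 ?expR_gt0 // exprn_gt0 // (lt_le_trans ltr01).
have adm : admissible V S cf.
  split=> //; split; last by split.
  move=> i x; rewrite /supp (@eq_filter _ _ predT) ?filter_predT; last first.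
    by move=> a; rewrite /= cf0.
  exact: convZ_lattice_pts.
have [s sP] := fin; have [r [ur rP]] := solR_finite sP.
have sol E : E \in L0 -> exists x, solR S cf x /\
    forall a, a \in E <-> a \in S /\ forall b, b \in S ->
      expR (- t * wr b) * `|mon x b| <= K ^+ 2 * (expR (- t * wr a) * `|mon x a|).
  move=> EL; apply: (cell_solution uS (cellP E EL) Kp t0).
    apply: hK => //; apply: (residue_small Kp (cellP E EL) mu1).
      by move=> a aS aE; have [] := ht E EL a aS aE.
    move=> i; have /andP[y0 yle] := ye i; rewrite (ger0_norm (ltW y0)).
    apply: (@le_trans _ _ (e * expR (t * affv (c E) (d E) a0))).
      by rewrite ler_wpM2r ?expR_ge0.
    by apply: hM => //; rewrite ?le_max ?lexx ?orbT // lt_max ltr01.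
  by move=> a aS aE; have [] := ht E EL a aS aE.
exists (size r); split; first by exists S, cf; split=> //; exists r.
move=> L uL LP.
have [x xP] : {x : {fset pt n} -> 'cV[R]_n & forall E, E \in L0 -> solR S cf (x E) /\
    forall a, a \in E <-> a \in S /\ forall b, b \in S ->
      expR (- t * wr b) * `|mon (x E) b| <= K ^+ 2 * (expR (- t * wr a) * `|mon (x E) a|)}.
  apply: (@boolp.choice _ _ (fun E x => E \in L0 -> solR S cf x /\ forall a, a \in E <-> a \in S /\
    forall b, b \in S -> expR (- t * wr b) * `|mon x b| <=
      K ^+ 2 * (expR (- t * wr a) * `|mon x a|))) => E.
  by case: (boolP (E \in L0)) => [/sol[x hx]|_]; [exists x|exists 0].
have LL0 E : E \in L -> E \in L0 by move=> /LP/L0P.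
(* The dominant terms of [x E] determine [E], so [x] is injective on [L] and its values are real
   solutions. *)
rewrite -(size_map x); apply: uniq_leq_size.
  rewrite map_inj_in_uniq // => E E' /LL0/xP[_ hE] /LL0/xP[_ hE'] xE.
  by apply/fsetP => a; apply/idP/idP => [/hE|/hE']; rewrite ?xE -?xE => h; [apply/hE'|apply/hE]; rewrite -?xE.
by move=> _ /mapP[E /LL0/xP[sx _] ->]; apply/rP.
Qed.
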